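(* Let $\mathcal{A}$ be a central arrangement in $\mathbb{K}^{\ell+1}$ with $\ell\ge3$ and fix $H\in\mathcal{A}$. Then $\mathcal{A}$ is free if and only if both of the following hold: (i) $\mathcal{A}$ is locally free along $H$, i.e. $\mathcal{A}_x$ is free for all $x\in H\setminus\{0\}$; (ii) the restricted multiarrangement $(\mathcal{A}^H,\mathbf{k}^H_\mathcal{A})$ is free.
   Context: $\mathbb{K}$ a field of characteristic $0$, $S$ the polynomial ring on $\mathbb{K}^{\ell+1}$; each hyperplane $H'$ has a defining linear form $\alpha_{H'}$. An arrangement $\mathcal{B}$ is free if $D(\mathcal{B})=\{\delta\in\mathrm{Der}:\delta(\alpha_{H'})\in\alpha_{H'}S\ \forall H'\in\mathcal{B}\}$ is a free $S$-module. For $x\in\mathbb{K}^{\ell+1}$, $\mathcal{A}_x=\{H'\in\mathcal{A}:x\in H'\}$. The restricted multiarrangement $(\mathcal{A}^H,\mathbf{k}^H_\mathcal{A})$ is the arrangement $\{H'\cap H:H'\in\mathcal{A}\setminus\{H\}\}$ in $H$ with multiplicity $\mathbf{k}^H_\mathcal{A}(X)=\#\{H'\in\mathcal{A}\setminus\{H\}:H'\cap H=X\}$; it is free if $D(\mathcal{A}^H,\mathbf{k})=\{\delta\in\mathrm{Der}_H:\delta(\alpha_X)\in\alpha_X^{\mathbf{k}(X)}\mathbb{K}[H]\ \forall X\}$ is a free $\mathbb{K}[H]$-module. *)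

(* Defs.v *)
From HB Require Import structures.
From mathcomp Require Import all_boot all_order all_algebra.
From mathcomp Require Import mpoly.
Set Implicit Arguments. Unset Strict Implicit. Unset Printing Implicit Defensive.
Import Order.TTheory GRing.Theory.
Local Open Scope ring_scope.

Section Arr.
Variable K : fieldType.

(* A derivation of K[x_0..x_{m-1}] (over K) is identified with the family of
   its values on the variables: delta = \sum_i (d i) * d/dx_i. *)
Definition der (m : nat) := 'I_m -> {mpoly K[m]}.

Definition der_app (m : nat) (d : der m) (p : {mpoly K[m]}) : {mpoly K[m]} :=
  \sum_(i < m) d i * mderiv i p.

Definition linform (m : nat) (a : 'rV[K]_m) : {mpoly K[m]} :=
  \sum_(i < m) a 0 i *: 'X_i.

Definition pdvd (m : nat) (p q : {mpoly K[m]}) : Prop :=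
  exists r : {mpoly K[m]}, q = r * p.

Definition free_der_module (m : nat) (P : der m -> Prop) : Prop :=
  exists (k : nat) (b : 'I_k -> der m),
    (forall j, P (b j)) /\
    (forall c : 'I_k -> {mpoly K[m]},
        (forall i, \sum_(j < k) c j * b j i = 0) -> forall j, c j = 0) /\
    (forall d, P d -> exists c : 'I_k -> {mpoly K[m]},
        forall i, d i = \sum_(j < k) c j * b j i).

Definition proportional (m : nat) (a b : 'rV[K]_m) : Prop :=
  exists c : K, a = c *: b.

(* A central arrangement in K^n, given by a list of defining linear forms:
   all nonzero, and defining pairwise distinct hyperplanes. *)
Definition is_arrangement (n : nat) (A : seq 'rV[K]_n) : Prop :=
  (forall a, a \in A -> a != 0) /\
  (forall i j, (i < size A)%N -> (j < size A)%N -> i <> j ->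
     ~ proportional (nth 0 A i) (nth 0 A j)).

Definition Dmod (n : nat) (B : seq 'rV[K]_n) (d : der n) : Prop :=
  forall a, a \in B -> pdvd (linform a) (der_app d (linform a)).

Definition free_arr (n : nat) (B : seq 'rV[K]_n) : Prop :=
  free_der_module (Dmod B).

Definition on_hyp (n : nat) (a x : 'rV[K]_n) : bool := x *m a^T == 0.

Definition loc_arr (n : nat) (A : seq 'rV[K]_n) (x : 'rV[K]_n) :=
  [seq a <- A | on_hyp a x].

Definition locally_free_along (n : nat) (A : seq 'rV[K]_n) (aH : 'rV[K]_n) :=
  forall x : 'rV[K]_n, on_hyp aH x -> x != 0 -> free_arr (loc_arr A x).

(* Coordinates on H: a matrix M whose rows form a basis of H = ker aH
   (y in K^ell |-> y *m M in H). The restriction of a form a to H, in these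
   coordinates, is the form (M *m a^T)^T on K^ell. *)
Definition param_of (ell : nat) (aH : 'rV[K]_ell.+1) (M : 'M[K]_(ell, ell.+1)) :=
  forall x : 'rV[K]_ell.+1, (x <= M)%MS = on_hyp aH x.

Definition restr_form (ell : nat) (M : 'M[K]_(ell, ell.+1)) (a : 'rV[K]_ell.+1)
  : 'rV[K]_ell := (M *m a^T)^T.

Definition deleted (n : nat) (A : seq 'rV[K]_n) (aH : 'rV[K]_n) :=
  [seq a <- A | a != aH].

(* Ziegler multiplicity of X = H' cap H (H' = ker a): the number of H'' = ker a''
   in A \ {H} with H'' cap H = X.  Since H' <> H, H' cap H is the common
   kernel of span(aH, a), so H'' cap H = H' cap H iff a'' lies in the row
   space of (aH; a). *)
Definition zmult (n : nat) (A : seq 'rV[K]_n) (aH : 'rV[K]_n)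
  (a : 'rV[K]_n) : nat :=
  count (fun a'' => (a'' <= col_mx aH a)%MS) (deleted A aH).

Definition Dmulti (ell : nat) (A : seq 'rV[K]_ell.+1) (aH : 'rV[K]_ell.+1)
  (M : 'M[K]_(ell, ell.+1)) (d : der ell) : Prop :=
  forall a, a \in deleted A aH ->
    pdvd (linform (restr_form M a) ^+ zmult A aH a)
         (der_app d (linform (restr_form M a))).

Definition restr_multi_free (ell : nat) (A : seq 'rV[K]_ell.+1)
  (aH : 'rV[K]_ell.+1) : Prop :=
  exists M : 'M[K]_(ell, ell.+1), param_of aH M /\ free_der_module (Dmulti A aH M).

End Arr.

(* Main.v *)
Require Import Defs.
From HB Require Import structures.
From mathcomp Require Import all_boot all_order all_algebra.
From mathcomp Require Import mpoly.
From mathcomp Require Import ring zify.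
Set Implicit Arguments.
Unset Strict Implicit.
Unset Printing Implicit Defensive.
Import Order.TTheory GRing.Theory.
Local Open Scope ring_scope.

(** Choose coordinates [x, z] with [H = {z = 0}] and the last basis vector on no
    hyperplane, so that every form of the arrangement is monic in [z] up to a
    constant.  Then [D(A)] is the sum of the Euler derivation and the module [D0] of
    derivations killing [z], and setting [z = 0] maps [D0] to the module [E] of the
    restricted multiarrangement, with kernel [z D0].

    If [A] is free, this map is onto: an element of [E] lifts explicitly near each
    codimension-two flat inside [H], and the coefficients of these local lifts in a
    basis glue because distinct linear forms are coprime.  A graded exchange argument
    then yields a basis of [D0], which restricts to one of [E].

    Conversely, local freeness along [H] puts [x_i^N eta] in the image of [D0] for all
    [eta] in [E] and large [N].  The lifts of [x_i^N eta] for three variables satisfy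
    [x_j^N t_i = x_i^N t_j] modulo [z]; since [E] is free, exactness of the Koszul
    complex of three variables improves this to a congruence modulo [z^k D0] for any
    [k].  For [k] larger than the degree of [eta] the error is the Koszul coboundary
    of elements that lie in [D0] for degree reasons, so the [t_i] can be corrected to
    [x_i^N t] with [t] a lift of [eta].  Lifts of a homogeneous basis of [E] form a
    basis of [D0] by graded Nakayama. *)

Local Notation hc := (pihomog mdeg).

(** * Graded modules over a polynomial ring *)

Section Graded.
Variables (K : fieldType) (n : nat).
Local Notation S := {mpoly K[n]}.
Implicit Types (p q h : S).

(** Subtraction of naturals truncates, so the guard prevents the constant term from standing in for
    a component of negative degree. *)
Definition hshift (d e : nat) p : S := if (e <= d)%N then hc (d - e) p else 0.

Lemma pihomogM d e p h : h \is e.-homog -> hc d (p * h) = hshift d e p * h.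
Proof.
(* The bound exceeds [d] as well as the degree of [p], so that [d - e] indexes a component of
   [p]. *)
move=> hh; pose k := maxn (msize p) d.+1.
rewrite {1}(@pihomog_partitionE _ _ mdeg k p) ?leq_maxl //.
rewrite mulr_suml raddf_sum /=.
have E (i : 'I_k) : hc d (hc i p * h) = if (i + e == d)%N then hc i p * h else 0.
  have hg : hc i p * h \is (i + e).-homog by apply: dhomogM => //; apply: pihomogP.
  by case: eqP => [<-|/eqP ne]; [rewrite pihomog_dE | rewrite (pihomog_ne0 ne)].
rewrite (eq_bigr _ (fun i _ => E i)) /hshift; case: leqP => le_ed; last first.
  rewrite mul0r big1 // => i _; case: eqP => // eq_d.
  by move: le_ed; rewrite -eq_d ltnNge leq_addl.
have lt : (d - e < k)%N by rewrite (leq_ltn_trans (leq_subr _ _)) // leq_maxr.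
rewrite (bigD1 (Ordinal lt)) //= subnK // eqxx big1 ?addr0 // => i ne_i.
by case: eqP => // eq_d; case/eqP: ne_i; apply: val_inj; rewrite /= -eq_d addnK.
Qed.

Lemma pihomog0_coef p : hc 0 p = (p@_0%MM)%:MP.
Proof.
apply/mpolyP=> m; rewrite mcoeffC pihomogE raddf_sum /=.
rewrite (eq_bigr (fun i => p@_i * (i == m)%:R)); last first.
  by move=> i _; rewrite mcoeffZ mcoeffX.
rewrite big_mkcond /=.
case: (eqVneq 0%MM m) => [<-|ne]; rewrite ?mulr1 ?mulr0.
  case: (boolP (0%MM \in msupp p)) => h0.
    rewrite (bigD1_seq 0%MM) ?msupp_uniq //= mdeg0 !eqxx mulr1 big1 ?addr0 // => i ne.
    by rewrite (negbTE ne) mulr0 if_same.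
  rewrite memN_msupp_eq0 // big1_seq // => i /= ii; case: ifP => // _.
  case: eqP => [e0|]; last by rewrite mulr0.
  by move: ii; rewrite e0 (negbTE h0).
rewrite big1 // => i _; rewrite mdeg_eq0; case: eqP => // ->.
by rewrite (negbTE ne) mulr0.
Qed.

Lemma hshift_self d p : hshift d d p = (p@_0%MM)%:MP.
Proof. by rewrite /hshift leqnn subnn pihomog0_coef. Qed.

Lemma scalemx_domain_eq0 r m p (G : 'M[S]_(r, m)) : p != 0 -> p *: G = 0 -> G = 0.
Proof.
move=> nzp /matrixP pG; apply/matrixP=> i j; move/eqP: (pG i j).
by rewrite !mxE mulf_eq0 (negbTE nzp) => /eqP.
Qed.

Definition homog_mx r m (G : 'M[S]_(r, m)) (ds : 'I_r -> nat) :=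
  forall i j, G i j \is (ds i).-homog.

Definition hcomp r m (d : nat) (G : 'M[S]_(r, m)) := map_mx (hc d) G.

Lemma homog_hcomp r m d (G : 'M[S]_(r, m)) : homog_mx (hcomp d G) (fun=> d).
Proof. by move=> i j; rewrite mxE; apply: pihomogP. Qed.

Lemma hcomp_id r m d (G : 'M[S]_(r, m)) :
  homog_mx G (fun=> d) -> hcomp d G = G.
Proof. by move=> hG; apply/matrixP=> i j; rewrite mxE pihomog_dE. Qed.

Lemma hcompD r m d (G G' : 'M[S]_(r, m)) :
  hcomp d (G + G') = hcomp d G + hcomp d G'.
Proof. by apply/matrixP=> i j; rewrite !mxE raddfD. Qed.

Lemma hcompB r m d (G G' : 'M[S]_(r, m)) :
  hcomp d (G - G') = hcomp d G - hcomp d G'.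
Proof. by apply/matrixP=> i j; rewrite !mxE raddfB. Qed.

Lemma hcompZ r m d e h (G : 'M[S]_(r, m)) : h \is e.-homog ->
  hcomp d (h *: G) = if (e <= d)%N then h *: hcomp (d - e) G else 0.
Proof.
move=> hh; apply/matrixP=> i j; rewrite !mxE mulrC (pihomogM _ _ hh) /hshift.
by case: ifP => _; rewrite !mxE ?mul0r // mulrC.
Qed.

Lemma hcomp_mul r m d (c : 'rV[S]_r) (G : 'M[S]_(r, m)) ds : homog_mx G ds ->
  hcomp d (c *m G) = (\row_i hshift d (ds i) (c 0 i)) *m G.
Proof.
move=> hG; apply/matrixP=> i j; rewrite !mxE raddf_sum /=.
by apply: eq_bigr => l _; rewrite !mxE (pihomogM _ _ (hG l j)) ord1.
Qed.

Lemma hcompZ_homog m d p (v : 'rV[S]_m) : homog_mx v (fun=> d) ->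
  hcomp d (p *: v) = (p@_0%MM)%:MP *: v.
Proof.
move=> hv; apply/matrixP=> i j; rewrite !mxE.
by rewrite (pihomogM _ _ (hv i j)) hshift_self.
Qed.

Lemma sum_hcomp r m (G : 'M[S]_(r, m)) :
  exists N, G = \sum_(d < N) hcomp d G.
Proof.
exists (\max_(t : 'I_r * 'I_m) msize (G t.1 t.2)); apply/matrixP=> i j.
rewrite summxE {1}(@pihomog_partitionE _ _ mdeg _ (G i j) (leqnn _)).
set N := (X in _ = \sum_(d < X) _).
have le : (msize (G i j) <= N)%N by apply: (leq_bigmax (i, j)).
rewrite -(@pihomog_partitionE _ _ mdeg _ (G i j) (leqnn _)).
rewrite {1}(@pihomog_partitionE _ _ mdeg N (G i j) le).
by apply: eq_bigr => d _; rewrite mxE.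
Qed.

Definition submod m (P : 'rV[S]_m -> Prop) :=
  P 0 /\ forall f u v, P u -> P v -> P (f *: u + v).

Definition graded m (P : 'rV[S]_m -> Prop) :=
  forall d v, P v -> P (hcomp d v).

Definition is_basis m (P : 'rV[S]_m -> Prop) k (B : 'M[S]_(k, m)) :=
  [/\ forall i, P (row i B),
      forall c : 'rV_k, c *m B = 0 -> c = 0
    & forall v, P v -> exists c : 'rV_k, v = c *m B].

Section Submod.
Variables (m : nat) (P : 'rV[S]_m -> Prop).
Hypothesis sP : submod P.

Lemma submod0 : P 0. Proof. by case: sP. Qed.

Lemma submodZ f u : P u -> P (f *: u).
Proof. by move=> Pu; rewrite -[_ *: _]addr0; apply: (proj2 sP) => //; apply: submod0. Qed.

Lemma submodD u v : P u -> P v -> P (u + v).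
Proof. by move=> Pu Pv; rewrite -[u]scale1r; apply: (proj2 sP). Qed.

Lemma submodB u v : P u -> P v -> P (u - v).
Proof. by move=> Pu Pv; rewrite addrC -scaleN1r; apply: (proj2 sP). Qed.

Lemma submod_mul k (c : 'rV[S]_k) (B : 'M_(k, m)) :
  (forall i, P (row i B)) -> P (c *m B).
Proof.
move=> PB; rewrite mulmx_sum_row; apply: big_ind => //.
- exact: submod0.
- exact: submodD.
- by move=> i _; apply: submodZ.
Qed.

End Submod.

Lemma span_sum m k (B : 'M[S]_(k, m)) I (r : seq I) (F : I -> 'rV_m) :
  (forall i, exists c : 'rV_k, F i = c *m B) ->
  exists c : 'rV_k, \sum_(i <- r) F i = c *m B.
Proof.
move=> sF; apply: (big_ind (fun v => exists c : 'rV_k, v = c *m B)) => [|u v [c ->] [c' ->]|i _] //.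
- by exists 0; rewrite mul0mx.
- by exists (c + c'); rewrite mulmxDl.
Qed.

(* Since [C *m B = q *: G] and [B = L *m G], independence of [B] gives
   [L *m C = q%:M], so at the origin some maximal minor of [C] is invertible.
   The matching rows of [G] generate up to a factor with nonzero constant
   term, and that factor disappears on taking homogeneous components. *)
Lemma homog_basis_exchange m (P : 'rV[S]_m -> Prop) k r (B : 'M_(k, m))
    (G : 'M_(r, m)) ds (L : 'M_(k, r)) q :
    submod P -> graded P -> (forall i, P (row i G)) -> homog_mx G ds ->
    (forall c : 'rV_k, c *m B = 0 -> c = 0) -> q@_0%MM != 0 ->
    (forall v, P v -> exists c : 'rV_k, q *: v = c *m B) -> B = L *m G ->
  exists f : 'I_k -> 'I_r, injective f /\ is_basis P (rowsub f G).
Proof.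
move=> sP gP PG hG indB q0 genB defB.
have [C0 defC0] := fin_all_exists (fun i => genB (row i G) (PG i)).
pose C := \matrix_(i < r) C0 i.
have defC : q *: G = C *m B.
  by apply/row_matrixP=> i; rewrite row_mul rowK -defC0 linearZ.
have LC : L *m C = q%:M.
  apply/row_matrixP=> i; apply/eqP; rewrite -subr_eq0; apply/eqP/indB.
  rewrite -linearB /= -row_mul mulmxBl -mulmxA -defC -scalemxAr -defB.
  by rewrite mul_scalar_mx subrr row0.
pose c0 : {rmorphism S -> K} := mcoeff (0%MM : 'X_{1..n}).
have rfC : row_full (map_mx c0 C).
  apply/row_fullP; exists ((c0 q)^-1 *: map_mx c0 L).
  rewrite -scalemxAl -map_mxM LC map_scalar_mx scale_scalar_mx.
  by rewrite mulVf.
pose f := fullrankfun rfC; pose C' := rowsub f C; pose D := \det C'.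
have D0 : D@_0%MM != 0.
  rewrite -[D@__]/(c0 D) /D -(det_map_mx c0) -unitfE -unitmxE.
  by rewrite /C' map_mxsub fullrowsub_unit.
have nzD : D != 0 by apply: contraNneq D0 => ->; rewrite mcoeff0.
have nzq : q != 0 by apply: contraNneq q0 => ->; rewrite mcoeff0.
pose G' := rowsub f G; have defG' : q *: G' = C' *m B.
  rewrite mul_rowsub_mx -defC; apply/matrixP=> i j.
  by rewrite !mxE.
exists f; split; first exact: fullrankfun_inj.
split=> [i|c cG|v Pv].
- by rewrite row_rowsub.
- have : c *m C' = 0.
    by apply: indB; rewrite -mulmxA -defG' -scalemxAr cG scaler0.
  move=> /(congr1 (mulmx^~ (\adj C'))); rewrite -mulmxA mul_mx_adj mul0mx.
  by rewrite mul_mx_scalar; apply: scalemx_domain_eq0.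
- have [N ->] := sum_hcomp v; apply: span_sum => d.
  set w := hcomp d v; have [c defw] : exists c : 'rV_k, q *: w = c *m B.
    by apply: genB; apply: gP.
  (* By Cramer's rule [D *: c] is [c *m \adj C' *m C'], and [C' *m B] equals [q *: G']. *)
  have E : (D * q) *: w = (q *: (c *m \adj C')) *m G'.
    rewrite -scalerA defw -[RHS]scalemxAl [RHS]scalemxAr defG' !mulmxA.
    by rewrite -(mulmxA c) mul_adj_mx mul_mx_scalar scalemxAl.
  have hG' : homog_mx G' (ds \o f) by move=> i j; rewrite mxE; apply: hG.
  have hw : homog_mx w (fun=> d) by apply: homog_hcomp.
  move: (congr1 (hcomp d) E); rewrite (hcomp_mul _ _ hG') hcompZ_homog //.
  set u := mcoeff _ _; set c' := \row_i _ => E'.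
  have u0 : u != 0 by rewrite /u -[mcoeff _ _]/(c0 (D * q)) rmorphM /= mulf_neq0.
  exists (u^-1%:MP *: c'); rewrite -scalemxAl -E' scalerA -mpolyCM mulVf //.
  by rewrite scale1r.
Qed.

(** The homogeneous components of the rows of [B], stacked degree by degree, lie in [P] because [P]
    is graded, and [B] is the sum of its components. *)
Lemma homog_generators m (P : 'rV[S]_m -> Prop) k (B : 'M_(k, m)) :
    graded P -> (forall i, P (row i B)) ->
  exists r (G : 'M_(r, m)) ds (L : 'M_(k, r)),
    [/\ forall i, P (row i G), homog_mx G ds & B = L *m G].
Proof.
move=> gP PB; have [N ->] := sum_hcomp B.
elim: N => [|N [r [G [ds [L [PG hG defG]]]]]].
  exists 0%N, 0, (fun=> 0%N), 0; split; [by case|by case|].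
  by rewrite big_ord0 mul0mx.
exists (r + k)%N, (col_mx G (hcomp N B)),
  (fun i => if split i is inl i' then ds i' else N), (row_mx L 1%:M).
split=> [i|i j|].
- rewrite -[i]splitK /unsplit; case: (split i) => i'.
    by rewrite rowKu.
  by rewrite rowKd /hcomp -map_row; apply: gP.
- rewrite -{1}[i]splitK /unsplit; case: (split i) => i'.
    by rewrite col_mxEu.
  by rewrite col_mxEd; apply: homog_hcomp.
- by rewrite big_ord_recr /= mul_row_col mul1mx -defG.
Qed.

(** The exchange lemma with [q = 1] selects exactly [k] of the homogeneous components of [B]. *)
Lemma homog_basis m (P : 'rV[S]_m -> Prop) k (B : 'M_(k, m)) :
    submod P -> graded P -> is_basis P B ->
  exists (G : 'M_(k, m)) ds, homog_mx G ds /\ is_basis P G.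
Proof.
move=> sP gP [PB indB genB].
have [r [G [ds [L [PG hG defB]]]]] := homog_generators gP PB.
have [||f [_ bf]] := homog_basis_exchange (q := 1) sP gP PG hG indB _ _ defB.
- by rewrite mcoeff1 eqxx oner_eq0.
- by move=> v Pv; rewrite scale1r; apply: genB.
by exists (rowsub f G), (ds \o f); split=> // i j; rewrite mxE; apply: hG.
Qed.

End Graded.

(** * Linear forms and divisibility *)

Section Divisibility.
Variables (K : fieldType) (m : nat).
Local Notation S := {mpoly K[m]}.
Implicit Types (p q r f g l : S).

Lemma pdvd0 l : pdvd l 0.
Proof. by exists 0; rewrite mul0r. Qed.

Lemma pdvdD l p q : pdvd l p -> pdvd l q -> pdvd l (p + q).
Proof. by case=> r -> [s ->]; exists (r + s); rewrite mulrDl. Qed.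

Lemma pdvd_mull l p q : pdvd l p -> pdvd l (q * p).
Proof. by case=> r ->; exists (q * r); rewrite mulrA. Qed.

Lemma pdvd_mulr l p q : pdvd l p -> pdvd l (p * q).
Proof. by rewrite mulrC; apply: pdvd_mull. Qed.

Lemma pdvdZ l p c : pdvd l p -> pdvd l (c *: p).
Proof. by rewrite -mul_mpolyC; apply: pdvd_mull. Qed.

Lemma pdvd_sum l I (s : seq I) (P : pred I) (F : I -> S) :
  (forall i, P i -> pdvd l (F i)) -> pdvd l (\sum_(i <- s | P i) F i).
Proof. by move=> dF; apply: big_ind => //; [apply: pdvd0 | apply: pdvdD]. Qed.

Lemma pdvd_refl l : pdvd l l. Proof. by exists 1; rewrite mul1r. Qed.

Lemma pdvd_trans p q r : pdvd p q -> pdvd q r -> pdvd p r.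
Proof. by case=> s -> [t ->]; exists (t * s); rewrite mulrA. Qed.

Lemma pdvd_exp p k k' : (k <= k')%N -> pdvd (p ^+ k) (p ^+ k').
Proof. by move=> le; exists (p ^+ (k' - k)); rewrite -exprD subnK. Qed.

(** Congruence modulo [l] respects the ring operations. Reduction modulo a linear form and
    restriction to [z = 0] both rest on this. *)
Lemma pdvd_subst k (l : S) (s t : k.-tuple S) (p : {mpoly K[k]}) :
    (forall i, pdvd l (tnth s i - tnth t i)) ->
  pdvd l ((p \mPo s) - (p \mPo t)).
Proof.
move=> dst; rewrite !comp_mpolyE -sumrB; apply: pdvd_sum => e _.
rewrite -scalerBr; apply: pdvdZ.
pose R x y := pdvd l (x - y).
have RM x x' y y' : R x x' -> R y y' -> R (x * y) (x' * y').
  rewrite /R => dx dy; have -> : x * y - x' * y' = (x - x') * y + x' * (y - y') by ring.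
  by apply: pdvdD; [apply: pdvd_mulr | apply: pdvd_mull].
apply: (big_ind2 R) => [| |i _]; rewrite /R.
- by rewrite subrr; apply: pdvd0.
- exact: RM.
elim: (e i) => [|j IHj]; first by rewrite !expr0 subrr; apply: pdvd0.
by rewrite !exprS; apply: RM; [apply: dst | apply: IHj].
Qed.

Lemma pdvd_hc d e l p : l \is e.-homog -> pdvd l p -> pdvd l (hc d p).
Proof. by move=> hl [r ->]; rewrite (pihomogM _ _ hl); eexists. Qed.

Lemma pdvd_prod_exp (I : eqType) (s : seq I) (F : I -> S) l :
  (forall i, i \in s -> pdvd l (F i)) -> pdvd (l ^+ size s) (\prod_(i <- s) F i).
Proof.
elim: s => [|i s IHs] dF; first by rewrite big_nil expr0; apply: pdvd_refl.
have [r Er] := dF i (mem_head _ _).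
have [|t Et] := IHs; first by move=> j js; apply: dF; rewrite inE js orbT.
by exists (r * t); rewrite big_cons Er Et /= exprS; ring.
Qed.

Lemma dhomog_subst k (t : k.-tuple S) d (p : {mpoly K[k]}) :
  (forall j, tnth t j \is 1.-homog) -> p \is d.-homog -> p \mPo t \is d.-homog.
Proof.
move=> ht /dhomogP hp; rewrite comp_mpolyE big_seq.
apply: rpred_sum => e /hp <-; apply: rpredZ.
have hM (s : seq 'I_k) : \prod_(j <- s) tnth t j ^+ e j
    \is (\sum_(j <- s) e j).-homog.
  elim: s => [|j s IHs]; first by rewrite !big_nil; apply: dhomog1.
  rewrite !big_cons; apply: dhomogM => //.
  by rewrite -[X in X.-homog]mul1n; apply: dhomogMn.
by have := hM (index_enum _); rewrite -mdegE.
Qed.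

Lemma pihomog_subst k (t : k.-tuple S) d (p : {mpoly K[k]}) :
  (forall j, tnth t j \is 1.-homog) -> hc d (p \mPo t) = hc d p \mPo t.
Proof.
move=> ht; pose N := maxn (msize p) d.+1; set q := RHS.
rewrite {1}(@pihomog_partitionE _ _ mdeg N p) ?leq_maxl //.
rewrite [X in hc d X]raddf_sum raddf_sum /=.
have lt : (d < N)%N by rewrite leq_maxr.
rewrite (bigD1 (Ordinal lt)) //= big1 ?addr0 => [|i ne].
  by rewrite pihomog_dE //; apply: dhomog_subst => //; apply: pihomogP.
apply: (@pihomog_ne0 _ _ mdeg i d); first by apply: contra ne => /eqP E; apply/eqP/val_inj.
by apply: dhomog_subst => //; apply: pihomogP.
Qed.

End Divisibility.

Lemma mpoly_hom_ext (K : fieldType) n (T : nzRingType)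
    (f g : {rmorphism {mpoly K[n]} -> T}) :
    (forall c, f c%:MP = g c%:MP) -> (forall i, f 'X_i = g 'X_i) -> f =1 g.
Proof.
move=> eqC eqX p; rewrite [p]mpolyE !raddf_sum /=; apply: eq_bigr => e _.
rewrite -mul_mpolyC !rmorphM eqC mpolyXE_id !rmorph_prod; congr (_ * _).
by apply: eq_bigr => i _; rewrite !rmorphXn eqX.
Qed.

Section LinearCombination.
Variables (K : fieldType) (n k : nat).
Local Notation S := {mpoly K[n]}.
Implicit Types (b : 'rV[K]_k) (v : 'rV[S]_k).

(** The value of a derivation on the linear form with coefficients [b], where [v] lists its values
    on the coordinates. Here [k] may differ from [n]: a derivation killing [z] is recorded by fewer
    values than there are variables. *)
Definition lapp b v : S := \sum_i b 0 i *: v 0 i.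

Lemma lapp_lin b f u v : lapp b (f *: u + v) = f * lapp b u + lapp b v.
Proof.
rewrite /lapp mulr_sumr -big_split; apply: eq_bigr => i _ /=.
by rewrite !mxE scalerDr scalerAr.
Qed.

Lemma lapp0 b : lapp b 0 = 0.
Proof. by rewrite /lapp big1 // => i _; rewrite mxE scaler0. Qed.

Lemma lappZ b f u : lapp b (f *: u) = f * lapp b u.
Proof. by rewrite -[_ *: _]addr0 lapp_lin lapp0 addr0. Qed.

Lemma lappD b u v : lapp b (u + v) = lapp b u + lapp b v.
Proof. by rewrite -[u]scale1r lapp_lin mul1r scale1r. Qed.

Lemma lappB b u v : lapp b (u - v) = lapp b u - lapp b v.
Proof. by rewrite addrC -scaleN1r lapp_lin mulN1r addrC. Qed.

Lemma lapp0l v : lapp 0 v = 0.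
Proof. by rewrite /lapp big1 // => i _; rewrite mxE scale0r. Qed.

Lemma lappZl c b v : lapp (c *: b) v = c *: lapp b v.
Proof. by rewrite scaler_sumr; apply: eq_bigr => i _; rewrite mxE scalerA. Qed.

Lemma lapp_hcomp b d v : lapp b (hcomp d v) = hc d (lapp b v).
Proof. by rewrite /lapp [RHS]raddf_sum; apply: eq_bigr => i _; rewrite mxE /= linearZ. Qed.

Lemma lapp_map n' (f : {rmorphism S -> {mpoly K[n']}}) b v :
    (forall c p, f (c *: p) = c *: f p) ->
  f (lapp b v) = \sum_i b 0 i *: (map_mx f v) 0 i.
Proof. by move=> fZ; rewrite raddf_sum; apply: eq_bigr => i _; rewrite mxE -fZ. Qed.

Lemma lapp_delta b f i : lapp b (f *: delta_mx 0 i) = b 0 i *: f.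
Proof.
rewrite lappZ /lapp (bigD1 i) //= big1 ?addr0 => [|j ne]; rewrite !mxE eqxx /=.
  by rewrite eqxx -scalerAr mulr1.
by rewrite (negbTE ne) scaler0.
Qed.

End LinearCombination.

Section LinearForms.
Variables (K : fieldType) (m : nat).
Local Notation S := {mpoly K[m]}.
Implicit Types (a b : 'rV[K]_m) (p q f g : S) (i j k : 'I_m).

Lemma linformD a b : linform (a + b) = linform a + linform b.
Proof. by rewrite -big_split; apply: eq_bigr => i _; rewrite mxE scalerDl. Qed.

Lemma linformZ c a : linform (c *: a) = c *: linform a.
Proof. by rewrite scaler_sumr; apply: eq_bigr => i _; rewrite mxE scalerA. Qed.

Lemma linform_delta i : linform (delta_mx 0 i : 'rV[K]_m) = 'X_i.
Proof.
rewrite /linform (bigD1 i) //= big1 ?addr0 => [|j ne]; rewrite mxE eqxx /=.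
  by rewrite eqxx scale1r.
by rewrite (negbTE ne) scale0r.
Qed.

Lemma mcoeff_linform a i : (linform a)@_U_(i)%MM = a 0 i.
Proof.
rewrite raddf_sum (bigD1 i) //= big1 ?addr0 => [|j ne].
  by rewrite mcoeffZ mcoeffXU eqxx mulr1.
by rewrite mcoeffZ mcoeffXU (negbTE ne) mulr0.
Qed.

Lemma linform_inj a b : linform a = linform b -> a = b.
Proof.
by move=> eq_ab; apply/rowP=> i; rewrite -!mcoeff_linform eq_ab.
Qed.

Lemma linform_eq0 a : (linform a == 0) = (a == 0).
Proof.
apply/eqP/eqP => [la0|->]; last by rewrite /linform big1 // => i _; rewrite mxE scale0r.
by apply/rowP=> i; rewrite -mcoeff_linform la0 mcoeff0 mxE.
Qed.

Lemma dhomogU i : ('X_i : S) \is 1.-homog.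
Proof. by rewrite dhomogX /= mdeg1. Qed.

Lemma dhomog_linform a : linform a \is 1.-homog.
Proof. by apply: rpred_sum => i _; apply: rpredZ; apply: dhomogU. Qed.

(** In degree one only the constant term of the quotient contributes. *)
Lemma linform_dvd_linform a b : pdvd (linform a) (linform b) -> proportional b a.
Proof.
case=> r eq_b; exists (r@_0%MM); apply: linform_inj; rewrite linformZ.
rewrite -(pihomog_dE (dhomog_linform b)) eq_b (pihomogM _ _ (dhomog_linform a)).
by rewrite hshift_self mul_mpolyC.
Qed.

Definition elim_tuple a i : m.-tuple S :=
  [tuple if j == i then - (a 0 i)^-1 *: \sum_(k | k != i) a 0 k *: 'X_k
         else 'X_j | j < m].

(* Reduction modulo [linform a]; junk unless [a 0 i != 0]. *)
Definition elim_var a i : S -> S := comp_mpoly (elim_tuple a i).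

HB.instance Definition _ a i := GRing.RMorphism.copy (elim_var a i)
  (comp_mpoly (elim_tuple a i)).

Lemma elim_varU a i j : j != i -> elim_var a i 'X_j = 'X_j.
Proof.
by move=> ne; rewrite /elim_var comp_mpolyXU -tnth_nth tnth_mktuple (negbTE ne).
Qed.

Lemma elim_varZ a i c p : elim_var a i (c *: p) = c *: elim_var a i p.
Proof. exact: comp_mpolyZ. Qed.

Section Elim.
Variables (a : 'rV[K]_m) (i : 'I_m).
Hypothesis ai : a 0 i != 0.
Local Notation phi := (elim_var a i).

Lemma elim_var_linform : phi (linform a) = 0.
Proof.
rewrite /linform raddf_sum (bigD1 i) //= elim_varZ {1}/elim_var comp_mpolyXU.
rewrite -tnth_nth tnth_mktuple eqxx scalerA mulrN divff // scaleN1r.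
rewrite [X in _ + X](eq_bigr (fun j => a 0 j *: 'X_j)) ?addNr // => j ne.
by rewrite elim_varZ elim_varU.
Qed.

Lemma elim_var_mod p : pdvd (linform a) (p - phi p).
Proof.
rewrite -{1}(comp_mpoly_id p); apply: pdvd_subst => j.
rewrite !tnth_mktuple; case: eqP => [->|_]; last by rewrite subrr; apply: pdvd0.
exists ((a 0 i)^-1%:MP); rewrite mul_mpolyC [in RHS]/linform [in RHS](bigD1 i) //= scalerDr.
by rewrite scalerA mulVf // scale1r scaleNr opprK.
Qed.

Lemma elim_varP p : pdvd (linform a) p <-> phi p = 0.
Proof.
split=> [[r ->]|p0]; first by rewrite rmorphM /= elim_var_linform mulr0.
by move: (elim_var_mod p); rewrite p0 subr0.
Qed.

Lemma dhomog_elim_var d p : p \is d.-homog -> phi p \is d.-homog.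
Proof.
apply: dhomog_subst => j; rewrite tnth_mktuple; case: ifP => _; last exact: dhomogU.
by apply/rpredZ/rpred_sum => k _; apply/rpredZ/dhomogU.
Qed.

End Elim.

Lemma neq0_coord a : a != 0 -> exists i, a 0 i != 0.
Proof. by case/rV0Pn => i; exists i. Qed.

(** Reduction modulo [linform a] is a ring homomorphism into a domain, and its kernel is generated
    by [linform a]. *)
Lemma linform_prime a p q : a != 0 ->
  pdvd (linform a) (p * q) -> pdvd (linform a) p \/ pdvd (linform a) q.
Proof.
move=> /neq0_coord[i ai]; rewrite !(elim_varP ai) rmorphM /= => /eqP.
by rewrite mulf_eq0 => /orP[] /eqP; [left | right].
Qed.

Lemma linform_exp_dvd a (k : nat) p q : a != 0 -> ~ pdvd (linform a) q ->
  pdvd (linform a ^+ k) (p * q) -> pdvd (linform a ^+ k) p.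
Proof.
move=> nza nq; elim: k p => [|k IHk] p; first by exists p; rewrite expr0 mulr1.
move=> dpq; have [|[r defp]|/nq //] := @linform_prime a p q nza.
  by apply: pdvd_trans dpq; rewrite -{1}[linform a]expr1; apply: pdvd_exp.
have la0 : linform a != 0 by rewrite linform_eq0.
case: dpq => s; rewrite exprSr mulrA defp mulrAC => /(mulIf la0) eq_s.
have [t deft] : pdvd (linform a ^+ k) r by apply: IHk; exists s.
by exists t; rewrite deft mulrA.
Qed.

Lemma not_dvd_linform a b : ~~ (b <= a)%MS -> ~ pdvd (linform a) (linform b).
Proof. by move=> /negP nab /linform_dvd_linform [c defb]; apply: nab; apply/sub_rVP; exists c. Qed.

Lemma sub_rV_sym a b : b != 0 -> (b <= a)%MS -> (a <= b)%MS.
Proof.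
move=> nzb /sub_rVP[c defb]; apply/sub_rVP; exists c^-1.
have nzc : c != 0 by apply: contraNneq nzb => c0; rewrite defb c0 scale0r.
by rewrite defb scalerA mulVf // scale1r.
Qed.

Lemma linform_exp_sub a b (k : nat) : b != 0 -> (b <= a)%MS ->
  pdvd (linform b ^+ k) (linform a ^+ k).
Proof.
move=> nzb /(sub_rV_sym nzb) /sub_rVP[c ->]; exists ((c ^+ k)%:MP).
by rewrite linformZ exprZn mul_mpolyC.
Qed.

(** [L] may contain proportional forms, so the hypothesis asks for the multiplicity of each class.
    Splitting off the first form costs one factor of its own class and, by primality, none of the
    others. *)
Lemma prod_linform_dvd (L : seq 'rV[K]_m) f :
    (forall a, a \in L -> a != 0) ->
    (forall a, a \in L -> pdvd (linform a ^+ count (fun b => (b <= a)%MS) L) f) ->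
  pdvd (\prod_(a <- L) linform a) f.
Proof.
elim: L f => [|a L IHL] f nzL dL.
  by exists f; rewrite big_nil mulr1.
have nza : a != 0 by apply: nzL; rewrite mem_head.
have [r deff] := dL a (mem_head _ _).
move: deff; rewrite /= submx_refl add1n exprSr mulrA; set f' := r * _ => deff.
have [|b bL|s deff'] := IHL f'.
- by move=> b bL; apply: nzL; rewrite inE bL orbT.
- have nzb : b != 0 by apply: nzL; rewrite inE bL orbT.
  have := dL b; rewrite inE bL orbT /= => /(_ isT).
  case: (boolP (a <= b)%MS) => [sab|nsab] /=; last first.
    by rewrite deff; apply: linform_exp_dvd => //; apply: not_dvd_linform.
  move=> _; have sba := sub_rV_sym nza sab.
  have -> : count (fun b0 => (b0 <= b)%MS) L = count (fun b0 => (b0 <= a)%MS) L.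
    by apply: eq_count => x; apply/idP/idP => /submx_trans; apply.
  by apply: pdvd_mull; apply: linform_exp_sub.
by exists s; rewrite deff deff' big_cons; ring.
Qed.

Lemma der_app_linform (d : der K m) a :
  der_app d (linform a) = \sum_i a 0 i *: d i.
Proof.
apply: eq_bigr => i _; rewrite /linform raddf_sum (bigD1 i) //= big1 => [|j ne].
  have U0 : (U_(i) - U_(i))%MM = 0%MM by apply/mnmP=> l; rewrite mnmBE subnn mnm0E.
  rewrite linearZ /= mderivX mnm1E eqxx scale1r U0 mpolyX0 addr0.
  by rewrite -scalerAr mulr1.
by rewrite linearZ /= mderivX mnm1E (negbTE ne) scale0r scaler0.
Qed.

Lemma delta_rV_neq0 i : (delta_mx 0 i : 'rV[K]_m) != 0.
Proof. by apply/rV0Pn; exists i; rewrite mxE !eqxx oner_eq0. Qed.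

Lemma mpolyU_neq0 i : ('X_i : S) != 0.
Proof. by rewrite -linform_delta linform_eq0 delta_rV_neq0. Qed.

Lemma monomial_cross i j N p q : i != j ->
  'X_i ^+ N * p = 'X_j ^+ N * q -> exists r, p = 'X_j ^+ N * r /\ q = 'X_i ^+ N * r.
Proof.
move=> ne E; have nz := mpolyU_neq0 j.
have [r defp] : pdvd ('X_j ^+ N : S) p.
  have nd : ~ pdvd ('X_j : S) ('X_i ^+ N).
    have dj : (delta_mx 0 j : 'rV[K]_m) 0 j != 0 by rewrite mxE !eqxx oner_eq0.
    rewrite -(linform_delta j) (elim_varP dj) rmorphXn /= elim_varU //.
    by move/eqP; rewrite expf_eq0 (negbTE (mpolyU_neq0 i)) andbF.
  rewrite -(linform_delta j); apply: (@linform_exp_dvd _ N p ('X_i ^+ N)).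
  - exact: delta_rV_neq0.
  - by rewrite linform_delta.
  - by exists q; rewrite linform_delta mulrC E mulrC.
exists r; split; first by rewrite mulrC.
apply: (mulfI (expf_neq0 N nz)); rewrite -E defp; ring.
Qed.

Lemma mem_msupp_mulX i N p e : e \in msupp ('X_i ^+ N * p) -> (N <= e i)%N.
Proof.
rewrite mulrC mpolyXn (perm_mem (msuppMX _ _)) => /mapP[e' _ ->].
by rewrite mnmDE mulmnE mnm1E eqxx mul1n leq_addr.
Qed.

(** The ideal of ['X_i ^+ N] and ['X_j ^+ N] is monomial, so membership is tested on supports, and
    multiplying by ['X_k] leaves the exponents of [i] and [j] unchanged. *)
Lemma monomial_colon i j k N p (u v : S) : i != k -> j != k ->
    'X_k ^+ N * p = 'X_i ^+ N * u + 'X_j ^+ N * v ->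
  exists u' v', p = 'X_i ^+ N * u' + 'X_j ^+ N * v'.
Proof.
move=> nik njk E.
have supp e : e \in msupp p -> (N <= e i)%N || (N <= e j)%N.
  move=> ep; pose e' := (U_(k) *+ N + e)%MM.
  have : e' \in msupp ('X_k ^+ N * p).
    by rewrite mulrC mpolyXn (perm_mem (msuppMX _ _)); apply: map_f.
  have e'E l : l != k -> e' l = e l.
    by move=> nlk; rewrite mnmDE mulmnE mnm1E eq_sym (negbTE nlk) mul0n.
  rewrite E => /msuppD_le; rewrite mem_cat => /orP[] /mem_msupp_mulX.
    by rewrite e'E // => ->.
  by rewrite e'E // => ->; rewrite orbT.
have XE (l : 'I_m) (e : 'X_{1..m}) : (N <= e l)%N -> 'X_[e] = 'X_l ^+ N * 'X_[(e - U_(l) *+ N)%MM] :> S.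
  move=> le; rewrite mpolyXn -mpolyXD; congr 'X_[_]; apply/mnmP=> l'.
  rewrite mnmDE mnmBE mulmnE mnm1E; case: eqP => [<-|_]; rewrite ?mul0n ?subn0 //.
  by rewrite mul1n subnKC.
rewrite [p]mpolyE big_seq.
apply: (big_ind (fun x => exists u' v', x = 'X_i ^+ N * u' + 'X_j ^+ N * v' :> S)) => [|x y [u1 [v1 ->]] [u2 [v2 ->]]|e /supp].
- by exists 0, 0; rewrite !mulr0 addr0.
- by exists (u1 + u2), (v1 + v2); rewrite !mulrDr addrACA.
case/orP=> /XE ->.
- exists (p@_e *: 'X_[(e - U_(i) *+ N)%MM]), 0.
  by rewrite mulr0 addr0 scalerAr.
- exists 0, (p@_e *: 'X_[(e - U_(j) *+ N)%MM]).
  by rewrite mulr0 add0r scalerAr.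
Qed.

(** Exactness of the Koszul complex of the [N]-th powers of three variables: the colon property
    splits [pij], and coprimality of two of the powers then yields [qk]. *)
Lemma koszul_exact i j k N (pij pik pjk : S) : i != j -> i != k -> j != k ->
    'X_k ^+ N * pij - 'X_j ^+ N * pik + 'X_i ^+ N * pjk = 0 ->
  exists qi qj qk : S, [/\ pij = 'X_j ^+ N * qi - 'X_i ^+ N * qj,
    pik = 'X_k ^+ N * qi - 'X_i ^+ N * qk & pjk = 'X_k ^+ N * qj - 'X_j ^+ N * qk].
Proof.
move=> nij nik njk E.
have E1 : 'X_k ^+ N * pij = 'X_j ^+ N * pik + 'X_i ^+ N * (- pjk).
  by apply/eqP; rewrite -subr_eq0 -[X in _ == X]E; apply/eqP; ring.
have [qi [qj' defij]] := monomial_colon njk nik E1.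
have E2 : 'X_j ^+ N * ('X_k ^+ N * qi - pik) = 'X_i ^+ N * (- 'X_k ^+ N * qj' - pjk).
  apply/eqP; rewrite -subr_eq0 -[X in _ == X]E defij; apply/eqP; ring.
have nji : j != i by rewrite eq_sym.
have [qk [d1 d2]] := monomial_cross nji E2.
exists qi, (- qj'), qk; split.
- by rewrite defij; ring.
- by rewrite -d1; ring.
- by rewrite -d2; ring.
Qed.

End LinearForms.

(** * Restriction to the hyperplane *)

Section Restriction.
Variables (K : fieldType) (ell : nat).
Local Notation S := {mpoly K[ell.+1]}.
Local Notation R := {mpoly K[ell]}.
Local Notation wid := (widen_ord (leqnSn ell)).
Local Notation z := ('X_ord_max : S).
Implicit Types (a b : 'rV[K]_ell.+1) (p q f : S) (th : 'rV[S]_ell) (e : 'rV[R]_ell).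

(** Coefficients of the restriction of the form [a] to [z = 0]. *)
Definition bar a : 'rV[K]_ell := \row_i a 0 (wid i).

Definition res_tuple : ell.+1.-tuple R :=
  [tuple oapp (fun i => 'X_i) 0 (unlift ord_max j) | j < ell.+1].

Definition res : S -> R := comp_mpoly res_tuple.

HB.instance Definition _ := GRing.RMorphism.copy res (comp_mpoly res_tuple).

Lemma widE (i : 'I_ell) : wid i = lift ord_max i.
Proof. by apply: val_inj; rewrite /= /bump leqNgt ltn_ord. Qed.

Lemma resU i : res 'X_(wid i) = 'X_i.
Proof. by rewrite /res comp_mpolyXU -tnth_nth tnth_mktuple widE liftK. Qed.

Lemma res_last : res z = 0.
Proof. by rewrite /res comp_mpolyXU -tnth_nth tnth_mktuple unlift_none. Qed.

Lemma resZ c p : res (c *: p) = c *: res p.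
Proof. exact: comp_mpolyZ. Qed.

Lemma res_lapp (b : 'rV[K]_ell) th : res (lapp b th) = lapp b (map_mx res th).
Proof. exact: (@lapp_map _ _ _ _ res b th resZ). Qed.

Lemma res_linform a : res (linform a) = linform (bar a).
Proof.
rewrite /linform raddf_sum big_ord_recr /= resZ res_last scaler0 addr0.
by apply: eq_bigr => i _; rewrite resZ resU mxE.
Qed.

Lemma dhomog_res_tuple j : tnth res_tuple j \is 1.-homog.
Proof.
rewrite tnth_mktuple; case: (unlift _ _) => [i|]; last exact: rpred0.
exact: dhomogU.
Qed.

Lemma res_hc d p : res (hc d p) = hc d (res p).
Proof. by rewrite /res -pihomog_subst //; apply: dhomog_res_tuple. Qed.

Lemma map_res_hcomp r k d (G : 'M[S]_(r, k)) :
  map_mx res (hcomp d G) = hcomp d (map_mx res G).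
Proof. by apply/matrixP=> i j; rewrite !mxE res_hc. Qed.

Lemma mwidenU i : mwiden ('X_i : R) = 'X_(wid i).
Proof. by rewrite mwidenX mnmwiden1. Qed.

Lemma mwidenK : cancel (@mwiden ell K) res.
Proof.
apply: (@mpoly_hom_ext K ell _ (res \o @mwiden ell K) idfun) => [c|i] /=.
  by rewrite mwidenC /res comp_mpolyC.
by rewrite mwidenU resU.
Qed.

Lemma map_mwidenK r k (G : 'M[R]_(r, k)) : map_mx res (map_mx (@mwiden ell K) G) = G.
Proof. by apply/matrixP=> i j; rewrite !mxE mwidenK. Qed.

Lemma mwiden_lapp (b : 'rV[K]_ell) e :
  mwiden (lapp b e) = lapp b (map_mx (@mwiden ell K) e).
Proof. exact: (@lapp_map _ _ _ _ (@mwiden ell K) b e (@mwidenZ _ _)). Qed.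

Lemma res_mod p : pdvd z (p - mwiden (res p)).
Proof.
pose t := [tuple mwiden (tnth res_tuple j) | j < ell.+1].
have -> : mwiden (res p) = p \mPo t.
  apply: (@mpoly_hom_ext K _ _ (@mwiden ell K \o res) (comp_mpoly t)) => [c|i] /=.
    by rewrite /res !comp_mpolyC mwidenC.
  by rewrite /res !comp_mpolyXU -!tnth_nth !tnth_mktuple.
rewrite -{1}(comp_mpoly_id p); apply: pdvd_subst => j; rewrite !tnth_mktuple.
case: unliftP => [i ->|->] /=; last by rewrite mwiden0 subr0; apply: pdvd_refl.
by rewrite mwidenU widE subrr; apply: pdvd0.
Qed.

Lemma res_eq0 p : res p = 0 -> exists r, p = z * r.
Proof.
move=> p0; have [r] := res_mod p; rewrite p0 mwiden0 subr0 => ->.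
by exists r; rewrite mulrC.
Qed.

Lemma map_res_eq0 r k (G : 'M[S]_(r, k)) :
  map_mx res G = 0 -> exists G', G = z *: G'.
Proof.
move=> G0; have H (t : 'I_r * 'I_k) : exists q, G t.1 t.2 = z * q.
  by apply: res_eq0; move/matrixP/(_ t.1 t.2): G0; rewrite !mxE.
have [g Eg] := fin_all_exists H; exists (\matrix_(i, j) g (i, j)).
by apply/matrixP=> i j; rewrite !mxE -(Eg (i, j)).
Qed.

Lemma pdvd_res p q : pdvd p q -> pdvd (res p) (res q).
Proof. by case=> r ->; exists (res r); rewrite rmorphM. Qed.

Lemma map_resZ r k f (G : 'M[S]_(r, k)) : map_mx res (f *: G) = res f *: map_mx res G.
Proof. by apply/matrixP=> i j; rewrite !mxE rmorphM. Qed.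

End Restriction.

(** * Derivations killing [z] and the restricted multiarrangement *)

Section Modules.
Variables (K : fieldType) (ell : nat).
Local Notation S := {mpoly K[ell.+1]}.
Local Notation R := {mpoly K[ell]}.
Local Notation wid := (widen_ord (leqnSn ell)).
Local Notation z := ('X_ord_max : S).
Implicit Types (a b : 'rV[K]_ell.+1) (p q f : S) (th : 'rV[S]_ell) (e : 'rV[R]_ell).
Implicit Types (A : seq 'rV[K]_ell.+1) (v : 'rV[S]_ell.+1).

Definition Dvec n (A : seq 'rV[K]_n) (v : 'rV[{mpoly K[n]}]_n) :=
  forall a : 'rV[K]_n, a \in A -> pdvd (linform a) (lapp a v).

(* [th] lists the values on the first [ell] coordinates of a derivation that
   annihilates the last one. *)
Definition D0 A th := forall a, a \in A -> pdvd (linform a) (lapp (bar a) th).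

Definition Emod A aH e := forall a, a \in deleted A aH ->
  pdvd (linform (bar a) ^+ zmult A aH a) (lapp (bar a) e).

(** [Dvec], [D0] and [Emod] all have this shape. *)
Lemma submod_lapp n k (I : eqType) (s : seq I) (l : I -> {mpoly K[n]})
    (c : I -> 'rV[K]_k) :
  submod (fun v : 'rV[{mpoly K[n]}]_k =>
    forall i, i \in s -> pdvd (l i) (lapp (c i) v)).
Proof.
split=> [i _|f u v du dv i si]; first by rewrite lapp0; apply: pdvd0.
by rewrite lapp_lin; apply: pdvdD; [apply/pdvd_mull/du | apply: dv].
Qed.

Lemma graded_lapp n k (I : eqType) (s : seq I) (l : I -> {mpoly K[n]})
    (c : I -> 'rV[K]_k) (d : I -> nat) : (forall i, l i \is (d i).-homog) ->
  graded (fun v : 'rV[{mpoly K[n]}]_k =>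
    forall i, i \in s -> pdvd (l i) (lapp (c i) v)).
Proof.
move=> hl d' v dv i si; rewrite lapp_hcomp; apply: (@pdvd_hc _ _ _ (d i)) => //.
exact: dv.
Qed.

Lemma submod_Dvec n (A : seq 'rV[K]_n) : submod (Dvec A).
Proof. exact: (submod_lapp A (@linform K n) id). Qed.

Lemma graded_Dvec n (A : seq 'rV[K]_n) : graded (Dvec A).
Proof. exact: (@graded_lapp _ _ _ A _ id (fun=> 1%N) (@dhomog_linform K n)). Qed.

Lemma submod_D0 A : submod (D0 A).
Proof. exact: (submod_lapp A (@linform K _) (@bar K ell)). Qed.

Lemma graded_D0 A : graded (D0 A).
Proof. exact: (@graded_lapp _ _ _ A _ (@bar K ell) (fun=> 1%N) (@dhomog_linform K _)). Qed.

Lemma submod_Emod A aH : submod (Emod A aH).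
Proof.
exact: (submod_lapp _ (fun a => linform (bar a) ^+ zmult A aH a) (@bar K ell)).
Qed.

Lemma graded_Emod A aH : graded (Emod A aH).
Proof.
apply: (@graded_lapp _ _ _ _ (fun a => linform (bar a) ^+ zmult A aH a) (@bar K ell)
  (fun a => 1 * zmult A aH a)%N) => a.
exact/dhomogMn/dhomog_linform.
Qed.

(** Right multiplication appends a zero last coordinate, so [ell] values become a full derivation
    that annihilates [z]. *)
Definition incl : 'M[S]_(ell, ell.+1) := \matrix_(i, j) (j == wid i)%:R.

Lemma mul_incl r (G : 'M[S]_(r, ell)) i j : (G *m incl) i (wid j) = G i j.
Proof.
rewrite mxE (bigD1 j) //= mxE eqxx mulr1 big1 ?addr0 // => l ne.
rewrite mxE; case: eqP => [/(congr1 val) /= E|]; last by rewrite mulr0.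
by case/eqP: ne; apply: val_inj.
Qed.

Lemma mul_incl_last r (G : 'M[S]_(r, ell)) i : (G *m incl) i ord_max = 0.
Proof.
rewrite mxE big1 // => l _; rewrite mxE; case: eqP => [/(congr1 val) /= E|_].
  by move: (ltn_ord l); rewrite -E ltnn.
by rewrite mulr0.
Qed.

Lemma mul_incl_inj r : injective (fun G : 'M[S]_(r, ell) => G *m incl).
Proof. by move=> G G' /matrixP E; apply/matrixP=> i j; rewrite -!mul_incl E. Qed.

Lemma lapp_incl a th : lapp a (th *m incl) = lapp (bar a) th.
Proof.
rewrite /lapp big_ord_recr /= mul_incl_last scaler0 addr0.
by apply: eq_bigr => i _; rewrite mul_incl mxE.
Qed.

Lemma Dvec_incl A th : Dvec A (th *m incl) <-> D0 A th.
Proof. by split=> H a aA; move: (H a aA); rewrite lapp_incl. Qed.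

Definition euler : 'rV[S]_ell.+1 := \row_j 'X_j.

Lemma lapp_euler a : lapp a euler = linform a.
Proof. by apply: eq_bigr => i _; rewrite mxE. Qed.

Lemma Dvec_euler A : Dvec A euler.
Proof. by move=> a _; rewrite lapp_euler; apply: pdvd_refl. Qed.

(** The last coordinate determines the Euler coefficient, because it is [z] for [euler] and zero on
    the image of [incl]. *)
Lemma euler_incl_inj f f' th th' :
  f *: euler + th *m incl = f' *: euler + th' *m incl -> f = f' /\ th = th'.
Proof.
move=> E; have Ef : f = f'.
  move/matrixP/(_ 0 ord_max): (E); rewrite mxE [RHS]mxE !mul_incl_last !addr0.
  by rewrite !mxE => /(mulIf (mpolyU_neq0 _ _)).
by split=> //; move: E; rewrite Ef => /addrI /mul_incl_inj.
Qed.

(* [normal_bar] says [H = {z = 0}], and [normal_last] that no hyperplane contains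
   the last basis vector. *)
Record normal_arr A aH : Prop := NormalArr {
  normal_uniq : uniq A;
  normal_sep : forall a b, a \in A -> b \in A -> a != b -> ~~ (a <= b)%MS;
  normal_last : forall a, a \in A -> a 0 ord_max != 0;
  normal_bar : bar aH = 0;
  normal_mem : aH \in A }.

Lemma normal_filter A aH (P : pred 'rV[K]_ell.+1) :
  P aH -> normal_arr A aH -> normal_arr (filter P A) aH.
Proof.
move=> PH [u s l b0 H]; split=> //.
- exact: filter_uniq.
- by move=> a b; rewrite !mem_filter => /andP[_ ?] /andP[_ ?]; apply: s.
- by move=> a; rewrite mem_filter => /andP[_ ?]; apply: l.
- by rewrite mem_filter PH.
Qed.

Section Normal.
Variables (A : seq 'rV[K]_ell.+1) (aH : 'rV[K]_ell.+1).
Hypothesis nA : normal_arr A aH.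
Local Notation del := (deleted A aH).

Lemma mem_deleted a : (a \in del) = (a != aH) && (a \in A).
Proof. by rewrite mem_filter. Qed.

Lemma linform_aH : linform aH = aH 0 ord_max *: z.
Proof.
rewrite /linform big_ord_recr /= big1 ?add0r // => i _.
by move/rowP/(_ i): (normal_bar nA); rewrite !mxE => ->; rewrite scale0r.
Qed.

Lemma lapp_aH v : lapp aH v = aH 0 ord_max *: v 0 ord_max.
Proof.
rewrite /lapp big_ord_recr /= big1 ?add0r // => i _.
by move/rowP/(_ i): (normal_bar nA); rewrite !mxE => ->; rewrite scale0r.
Qed.

Lemma aH_last : aH 0 ord_max != 0.
Proof. exact: (normal_last nA (normal_mem nA)). Qed.

Lemma arr_neq0 a : a \in A -> a != 0.
Proof. by move/(normal_last nA); apply: contraNneq => ->; rewrite mxE. Qed.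

(** A form that vanishes on [z = 0] is a multiple of [aH], with the factor read off from the last
    coefficient. *)
Lemma eq_bar a b c : bar b = c *: bar a ->
  b = ((b 0 ord_max - c * a 0 ord_max) / aH 0 ord_max) *: aH + c *: a.
Proof.
move=> E; apply/rowP=> j; rewrite !mxE; case: (unliftP ord_max j) => [i ->|->].
  rewrite -widE; move/rowP/(_ i): E; rewrite !mxE => ->.
  by move/rowP/(_ i): (normal_bar nA); rewrite !mxE => ->; rewrite mulr0 add0r.
by rewrite divfK ?aH_last // subrK.
Qed.

Lemma bar_neq0 a : a \in del -> bar a != 0.
Proof.
rewrite mem_deleted => /andP[ne aA]; apply/eqP => ba0.
have := normal_sep nA aA (normal_mem nA) ne; rewrite (@eq_bar aH a 0) ?scale0r ?addr0 //.
by rewrite scalemx_sub.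
Qed.

Lemma sub_bar a b : (b <= col_mx aH a)%MS = (bar b <= bar a)%MS.
Proof.
apply/idP/sub_rVP => [|[c /eq_bar ->]].
  rewrite -addsmxE => /sub_addsmxP[[u w] /= ->]; exists (w 0 0).
  apply/rowP=> i; rewrite !mxE !big_ord1.
  by move/rowP/(_ i): (normal_bar nA); rewrite !mxE => ->; rewrite mulr0 add0r.
by rewrite -addsmxE addmx_sub_adds // scalemx_sub.
Qed.

Lemma zmultE a : zmult A aH a = count (fun b => (bar b <= bar a)%MS) del.
Proof. by apply: eq_count => b; rewrite sub_bar. Qed.

Lemma not_dvd_z a : a \in del -> ~ pdvd (linform a) z.
Proof.
rewrite mem_deleted => /andP[ne aA] dz.
have : pdvd (linform a) (linform aH) by rewrite linform_aH; apply: pdvdZ.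
by apply: not_dvd_linform; apply: (normal_sep nA (normal_mem nA) aA); rewrite eq_sym.
Qed.

Lemma D0_cancel q th : (forall a, a \in del -> ~ pdvd (linform a) q) ->
  D0 A (q *: th) -> D0 A th.
Proof.
move=> nq Dth a aA; case: (eqVneq a aH) => [->|ne].
  by rewrite (normal_bar nA) lapp0l; apply: pdvd0.
have aD : a \in del by rewrite mem_deleted ne.
have := Dth a aA; rewrite lappZ => /(linform_prime (arr_neq0 aA)) [] //.
by move/(nq a aD).
Qed.

Lemma D0_ker th : D0 A th -> map_mx (@res K ell) th = 0 ->
  exists2 th', D0 A th' & th = z *: th'.
Proof.
move=> Dth /map_res_eq0[th' E]; exists th' => //.
by apply: (@D0_cancel z); [apply: not_dvd_z | rewrite -E].
Qed.

Local Notation parallel a := [seq b <- del | (bar b <= bar a)%MS].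

Lemma parallel_prod_dvd a : a \in del ->
  pdvd (linform (bar a) ^+ zmult A aH a)
    (\prod_(b <- parallel a) linform (bar b)).
Proof.
move=> aD; rewrite zmultE -size_filter; apply: pdvd_prod_exp => b.
rewrite mem_filter => /andP[/sub_rVP[c ->] _]; rewrite linformZ.
exact/pdvdZ/pdvd_refl.
Qed.

(** The forms that cut [H] in the same flat as [a] are pairwise coprime, and each divides the value
    at [bar a], since their restrictions are proportional to [bar a]. Hence their product divides
    it, and on [z = 0] this product becomes the required power up to a constant. *)
Lemma res_D0 th : D0 A th -> Emod A aH (map_mx (@res K ell) th).
Proof.
move=> Dth a aD; rewrite -res_lapp.
apply: pdvd_trans (parallel_prod_dvd aD) _.
rewrite (eq_bigr (fun b => res (linform b))); last by move=> b _; rewrite res_linform.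
rewrite -rmorph_prod; apply: pdvd_res; apply: prod_linform_dvd => b.
  by rewrite mem_filter mem_deleted => /andP[_ /andP[_ /arr_neq0]].
move=> bL; have -> : count (fun x => (x <= b)%MS) (parallel a) = 1%N.
  rewrite (@eq_in_count _ _ (pred1 b)).
    by rewrite count_uniq_mem ?bL // !filter_uniq // (normal_uniq nA).
  move=> x xL /=; case: (eqVneq x b) => [->|ne]; first by rewrite submx_refl.
  apply/negbTE; move: xL bL; rewrite !mem_filter => /and3P[_ _ xA] /and3P[_ _ bA].
  exact: (normal_sep nA).
move: bL; rewrite expr1 mem_filter => /andP[/sub_rVP[c Ec] bD].
have nzc : c != 0 by apply: contraNneq (bar_neq0 bD) => c0; rewrite Ec c0 scale0r.
have -> : bar a = c^-1 *: bar b by rewrite Ec scalerA mulVf // scale1r.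
by rewrite lappZl; apply/pdvdZ/Dth; move: bD; rewrite mem_deleted => /andP[].
Qed.

(* Near a codimension-two flat [X] of [A] inside [H] the module [D0] is explicit:
   the factor [y^k] imposed on the restricted module lifts to the product of the
   [k] forms of [A] that vanish on [X]. *)
Lemma local_lift a e : a \in del -> Emod A aH e ->
  exists2 th, map_mx (@res K ell) th = e &
    forall b, b \in A -> (b == aH) || (bar b <= bar a)%MS ->
      pdvd (linform b) (lapp (bar b) th).
Proof.
move=> aD Ee; have [g Eg] := Ee a aD.
have [i0 ai0] := neq0_coord (bar_neq0 aD).
pose c b := bar b 0 i0 / bar a 0 i0.
have cE b : (bar b <= bar a)%MS -> bar b = c b *: bar a.
  case/sub_rVP=> c' Ec; have Eb0 : bar b 0 i0 = c' * bar a 0 i0 by rewrite Ec mxE.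
  by rewrite /c Eb0 mulfK.
have c0 b : b \in parallel a -> c b != 0.
  rewrite mem_filter => /andP[/cE Eb /bar_neq0]; apply: contraNneq => cb0.
  by rewrite Eb cb0 scale0r.
(* The scalars make every factor restrict to exactly [linform (bar a)]. *)
pose P := \prod_(b <- parallel a) ((c b)^-1 *: linform b).
have resP : res P = linform (bar a) ^+ zmult A aH a.
  rewrite rmorph_prod /= zmultE -size_filter big_seq.
  rewrite (eq_bigr (fun=> linform (bar a))); last first.
    move=> b bL; rewrite resZ res_linform.
    have Eb : bar b = c b *: bar a by apply: cE; move: bL; rewrite mem_filter => /andP[].
    by rewrite Eb linformZ scalerA mulVf ?scale1r ?c0.
  by rewrite -big_seq big_const_seq count_predT -Monoid.iteropE.
(* [u] corrects the value of the naive lift at [bar a] to a multiple of [P]. It vanishes on [z = 0],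
   so adding it in a coordinate where [bar a] is nonzero keeps the restriction equal to [e]. *)
pose u := P * mwiden g - mwiden (lapp (bar a) e).
pose th := map_mx (@mwiden ell K) e + ((bar a 0 i0)^-1 *: u) *: delta_mx 0 i0.
have resu : res u = 0.
  by rewrite rmorphB rmorphM /= !mwidenK resP Eg mulrC subrr.
have tha : lapp (bar a) th = P * mwiden g.
  rewrite lappD lapp_delta -mwiden_lapp scalerA divff // scale1r.
  by rewrite addrC subrK.
exists th.
  rewrite map_mxD map_mwidenK map_resZ resZ resu scaler0 scale0r addr0 //.
move=> b bA; case: (eqVneq b aH) => [->|ne] /= sb.
  by rewrite (normal_bar nA) lapp0l; apply: pdvd0.
rewrite (cE b sb) lappZl tha; apply: pdvdZ; apply: pdvd_mulr.
have bL : b \in parallel a by rewrite mem_filter sb mem_deleted ne.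
rewrite /P (perm_big _ (perm_to_rem bL)) big_cons; apply: pdvd_mulr.
exact/pdvdZ/pdvd_refl.
Qed.

Lemma D0_scale_prod (p : pred 'rV[K]_ell.+1) th :
    (forall b, b \in A -> p b -> pdvd (linform b) (lapp (bar b) th)) ->
  D0 A ((\prod_(b <- A | ~~ p b) linform b) *: th).
Proof.
move=> H b bA; rewrite lappZ; case: (boolP (p b)) => pb.
  by apply: pdvd_mull; apply: H.
apply: pdvd_mulr; rewrite (perm_big _ (perm_to_rem bA)) big_cons pb.
exact/pdvd_mulr/pdvd_refl.
Qed.

(** The condition at [H] makes the last coordinate a multiple [u * z]; subtracting [u *: euler]
    removes it. *)
Lemma Dvec_split v : Dvec A v ->
  exists u th, D0 A th /\ v = u *: euler + th *m incl.
Proof.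
move=> Dv; have [u Eu] : pdvd z (v 0 ord_max).
  have [r] := Dv aH (normal_mem nA); rewrite lapp_aH linform_aH => E.
  by exists r; apply: (scalerI aH_last); rewrite E scalerAr.
exists u, (\row_i (v 0 (wid i) - u * 'X_(wid i))).
have E : v = u *: euler + (\row_i (v 0 (wid i) - u * 'X_(wid i))) *m incl.
  apply/rowP=> j; rewrite [RHS]mxE; case: (unliftP ord_max j) => [i ->|->].
    by rewrite -widE mul_incl !mxE addrC subrK.
  by rewrite mul_incl_last !mxE Eu addr0.
split=> //; apply/Dvec_incl.
have -> : (\row_i (v 0 (wid i) - u * 'X_(wid i))) *m incl = v - u *: euler.
  by rewrite {2}E [u *: _ + _]addrC addrK.
by apply: (submodB (submod_Dvec A)) => //; apply: (submodZ (submod_Dvec A)); apply: Dvec_euler.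
Qed.

(** [Q] times the naive lift of [e] lies in [D0]; let [c] be its coefficients in [B]. Each local
    lift shows that on [z = 0] these are divisible by the power belonging to one flat, so by
    coprimality the restriction of [Q] divides them, and the quotients produce a lift of [e]. *)
Lemma res_D0_surj k (B : 'M[S]_(k, ell.+1)) e : is_basis (Dvec A) B ->
  Emod A aH e -> exists2 th, D0 A th & map_mx (@res K ell) th = e.
Proof.
case=> [DB indB genB] Ee.
pose Q := \prod_(b <- A | b != aH) linform b.
have defQ : Q = \prod_(b <- del) linform b by rewrite big_filter.
pose th0 := Q *: map_mx (@mwiden ell K) e.
have D0th0 : D0 A th0.
  apply: (@D0_scale_prod (pred1 aH)) => b _ /eqP ->.
  by rewrite (normal_bar nA) lapp0l; apply: pdvd0.
have [c Ec] := genB _ (proj2 (Dvec_incl A th0) D0th0).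
have resQ : res Q = \prod_(b <- map (@bar K ell) del) linform b.
  by rewrite defQ rmorph_prod big_map; apply: eq_bigr => b _; rewrite /= res_linform.
have resQ0 : res Q != 0.
  rewrite resQ prodf_seq_neq0; apply/allP=> b /mapP[b' b'D ->].
  by rewrite linform_eq0 bar_neq0.
have dvdc j : pdvd (res Q) (res (c 0 j)).
  rewrite resQ; apply: prod_linform_dvd => b /mapP[a aD ->]; first exact: bar_neq0.
  rewrite count_map -zmultE.
  have [tha resa Dtha] := local_lift aD Ee.
  pose qa := \prod_(b <- A | ~~ ((b == aH) || (bar b <= bar a)%MS)) linform b.
  pose pa := \prod_(b <- parallel a) linform b.
  have EQ : Q = pa * qa.
    rewrite defQ (bigID (fun b => (bar b <= bar a)%MS)) /= /pa -big_filter.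
    congr (_ * _); rewrite /deleted big_filter_cond.
    by apply: eq_bigl => x; rewrite negb_or.
  have D0a : D0 A (qa *: tha) by apply: D0_scale_prod.
  have [ca Eca] := genB _ (proj2 (Dvec_incl A _) D0a).
  (* Both elements restrict to [res Q *: e], so they differ by [z] times an element of [D0], and
     their coefficients in [B] agree modulo [z]. *)
  have [||th' D0th' Eth'] := @D0_ker (pa *: (qa *: tha) - th0).
  - apply: (submodB (submod_D0 A)) => //; exact: (submodZ (submod_D0 A)).
  - by rewrite scalerA -EQ -scalerBr map_resZ map_mxB resa map_mwidenK subrr scaler0.
  have [c' Ec'] := genB _ (proj2 (Dvec_incl A th') D0th').
  have : pa *: ca - c - z *: c' = 0.
    apply: indB; rewrite !mulmxBl -!scalemxAl -Eca -Ec -Ec'.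
    by rewrite !scalemxAl -!mulmxBl Eth' subrr mul0mx.
  move/rowP/(_ j)/(congr1 (@res K ell)); rewrite !mxE !rmorphB !rmorphM /=.
  rewrite res_last mul0r subr0 rmorph0 => /subr0_eq <-.
  apply: pdvd_mulr; apply: pdvd_trans (parallel_prod_dvd aD) _.
  have -> : res pa = \prod_(b <- parallel a) linform (bar b).
    by rewrite rmorph_prod; apply: eq_bigr => x _; rewrite /= res_linform.
  exact: pdvd_refl.
have [g Eg] := fin_all_exists dvdc.
pose gr := \row_j mwiden (g j).
have [c'' Ec''] : exists c'', c - Q *: gr = z *: c''.
  apply: map_res_eq0; apply/rowP=> j; rewrite !mxE rmorphB rmorphM /= mwidenK.
  by rewrite Eg mulrC subrr.
have [u [th [D0th Eth]]] := Dvec_split (submod_mul (submod_Dvec A) gr DB).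
have [u'' [th'' [D0th'' Eth'']]] := Dvec_split (submod_mul (submod_Dvec A) c'' DB).
exists th => //.
(* Splitting off the Euler parts of [c = Q *: gr + z *: c''] leaves an identity in [D0]; on [z = 0]
   the nonzero factor [res Q] cancels from it. *)
have [_ E0] : 0 = Q * u + z * u'' /\ th0 = Q *: th + z *: th''.
  apply: euler_incl_inj; rewrite scale0r add0r Ec.
  rewrite -[c](subrK (Q *: gr)) Ec'' mulmxDl -!scalemxAl Eth Eth''.
  rewrite !scalerDr !scalerDl !scalerA mulmxDl -!scalemxAl.
  by rewrite addrC addrACA.
move/(congr1 (map_mx (@res K ell))): E0.
rewrite map_mxD !map_resZ res_last scale0r addr0 map_mwidenK => E0.
apply: subr0_eq; apply: (scalemx_domain_eq0 resQ0).
by rewrite scalerBr -E0 subrr.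
Qed.

Lemma Dvec_basis_D0 k (G : 'M[S]_(k, ell)) :
  is_basis (D0 A) G -> is_basis (Dvec A) (col_mx euler (G *m incl)).
Proof.
case=> DG indG genG; split=> [i|c|v /Dvec_split[u [th [/genG[c ->] ->]]]].
- rewrite -[i]splitK /unsplit; case: (split i) => i'.
    by rewrite rowKu ord1 row_id; apply: Dvec_euler.
  by rewrite rowKd row_mul; apply/Dvec_incl.
- rewrite -[c]hsubmxK mul_row_col mulmxA.
  have -> : lsubmx c = (lsubmx c 0 0)%:M by apply: mx11_scalar.
  rewrite mul_scalar_mx -[0 in RHS](addr0) => E.
  have [|-> /indG ->] := @euler_incl_inj (lsubmx c 0 0) 0 (rsubmx c *m G) 0.
    by rewrite E scale0r mul0mx.
  by rewrite raddf0 row_mx0.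
- exists (row_mx u%:M c); rewrite mul_row_col mul_scalar_mx mulmxA //.
Qed.

(** Since [f] is injective, only [j0] selects the Euler row. The remaining rows come from [D0], and
    removing the Euler summand leaves a basis of it. *)
Lemma D0_basis_extract r k (G : 'M[S]_(r, ell)) (f : 'I_k -> 'I_(1 + r)) (j0 : 'I_k) :
    injective f -> f j0 = lshift r 0 ->
    is_basis (Dvec A) (rowsub f (col_mx euler (G *m incl))) ->
  exists k' (G' : 'M[S]_(k', ell)), is_basis (D0 A) G'.
Proof.
case: k f j0 => [|k] f j0; first by case: j0.
move=> inj_f Ej0; set F := rowsub _ _ => -[DF indF genF]; exists k.
(* The default row [0] is never taken, because [lift j0 j] differs from [j0]. *)
pose G' : 'M[S]_(k, ell) := \matrix_(j < k)
  (if split (f (lift j0 j)) is inr i then row i G else 0).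
have EF j : row (lift j0 j) F = row j G' *m incl.
  rewrite rowK row_rowsub -{1}[f _]splitK.
  case E: (split (f (lift j0 j))) => [i|i]; last by rewrite rowKd row_mul.
  have : f (lift j0 j) = f j0 by rewrite Ej0 -[f (lift _ _)]splitK E /= ord1.
  by move/inj_f/eqP; rewrite eq_sym (negbTE (neq_lift _ _)).
have EF0 : row j0 F = euler by rewrite row_rowsub Ej0 rowKu row_id.
have mulF (c : 'rV_k.+1) :
    c *m F = c 0 j0 *: euler + ((\row_j c 0 (lift j0 j)) *m G') *m incl.
  rewrite mulmx_sum_row (bigD1_ord j0) //= EF0; congr (_ + _).
  rewrite -mulmxA mulmx_sum_row; apply: eq_bigr => j _.
  by rewrite EF row_mul mxE.
exists G'; split=> [j|c cG|th /Dvec_incl/genF[c]].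
- by apply/Dvec_incl; rewrite -EF.
- pose c' := \row_j oapp (fun i => c 0 i) 0 (unlift j0 j).
  have Ec j : c' 0 (lift j0 j) = c 0 j by rewrite mxE liftK.
  have : c' = 0.
    apply: indF; rewrite mulF mxE unlift_none scale0r add0r.
    have -> : \row_j c' 0 (lift j0 j) = c by apply/rowP=> j; rewrite mxE Ec.
    by rewrite cG mul0mx.
  by move=> c'0; apply/rowP=> j; rewrite -Ec c'0 !mxE.
- rewrite mulF -[LHS]add0r -[0](scale0r euler) => /euler_incl_inj[_ ->].
  by eexists.
Qed.

(** The Euler derivation and the homogeneous components of the [D0] parts of [B] generate, so the
    exchange lemma picks a basis of [Dvec A] among them. It must include the Euler row, as all other
    rows have zero last coordinate. *)
Lemma D0_basis_Dvec k (B : 'M[S]_(k, ell.+1)) : is_basis (Dvec A) B ->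
  exists k' (G : 'M[S]_(k', ell)), is_basis (D0 A) G.
Proof.
case=> DB indB genB.
have /fin_all_exists[u Hu] : forall j : 'I_k, exists u, exists th,
  D0 A th /\ row j B = u *: euler + th *m incl by move=> j; apply: Dvec_split.
have /fin_all_exists[t Ht] := Hu; pose T := \matrix_(j < k) t j.
have DT j : D0 A (row j T) by rewrite rowK; case: (Ht j).
have [r [G [ds [L [DG hG defT]]]]] := homog_generators (graded_D0 (A := A)) DT.
pose F := col_mx euler (G *m incl).
have DF i : Dvec A (row i F).
  rewrite -[i]splitK /unsplit; case: (split i) => i'.
    by rewrite rowKu ord1 row_id; apply: Dvec_euler.
  by rewrite rowKd row_mul; apply/Dvec_incl.
have hF : homog_mx F (fun i => if split i is inr i' then ds i' else 1%N).
  move=> i j; rewrite -{1}[i]splitK /unsplit; case: (split i) => i'.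
    by rewrite col_mxEu mxE; apply: dhomogU.
  rewrite col_mxEd; case: (unliftP ord_max j) => [j' ->|->].
    by rewrite -widE mul_incl.
  by rewrite mul_incl_last; apply: rpred0.
have defB : B = row_mx (\col_j u j) L *m F.
  rewrite mul_row_col mulmxA -defT; apply/row_matrixP=> j.
  rewrite linearD /= !row_mul rowK; have [_ ->] := Ht j; congr (_ + _).
  by apply/rowP=> l; rewrite !mxE big_ord1 !mxE.
have [||f [inj_f bF]] :=
  homog_basis_exchange (q := 1) (submod_Dvec A) (graded_Dvec (A := A)) DF hF indB _ _ defB.
- by rewrite mcoeff1 eqxx oner_eq0.
- by move=> v Dv; rewrite scale1r; apply: genB.
have [/existsP[j0 /eqP Ej0]|] := boolP [exists j, f j == lshift r 0].
  exact: D0_basis_extract inj_f Ej0 bF.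
case: bF => _ _ genF.
rewrite negb_exists => /forallP nf; exfalso.
have [c /rowP/(_ ord_max)] := genF _ (Dvec_euler (A := A)).
rewrite mxE [RHS]mxE big1 => [/eqP|j _]; first by rewrite (negbTE (mpolyU_neq0 _ _)).
rewrite mxE -[f j]splitK /unsplit; case E: (split (f j)) => [i|i].
  by case/eqP: (nf j); rewrite -[f j]splitK E /= ord1.
by rewrite col_mxEd mul_incl_last mulr0.
Qed.

(** Surjectivity gives generation. A relation on [z = 0] lifts to an element of [z D0]; expanding it
    in [G] shows that the lifted coefficients are multiples of [z]. *)
Lemma Emod_basis_D0 k (G : 'M[S]_(k, ell)) :
    (forall e, Emod A aH e -> exists2 th, D0 A th & map_mx (@res K ell) th = e) ->
  is_basis (D0 A) G -> is_basis (Emod A aH) (map_mx (@res K ell) G).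
Proof.
move=> surj [DG indG genG]; split=> [i|c cG|e /surj[th /genG[c ->] <-]].
- by rewrite -map_row; apply: res_D0.
- have [|th' /genG[c' ->] E] :=
      D0_ker (submod_mul (submod_D0 A) (map_mx (@mwiden ell K) c) DG).
    by rewrite map_mxM map_mwidenK.
  have : map_mx (@mwiden ell K) c - z *: c' = 0.
    by apply: indG; rewrite mulmxBl E -scalemxAl subrr.
  move/(congr1 (map_mx (@res K ell))).
  by rewrite map_mxB map_mwidenK map_resZ res_last scale0r subr0 map_mx0.
- by exists (map_mx (@res K ell) c); rewrite map_mxM.
Qed.

End Normal.
End Modules.

(** * Lifting derivations from the hyperplane *)

Section PowersInIdeals.
Variables (K : fieldType) (m : nat).
Local Notation R := {mpoly K[m]}.
Implicit Types (J : R -> Prop) (p q f : R) (a w x : 'rV[K]_m).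

Definition is_ideal J := J 0 /\ forall f p q, J p -> J q -> J (f * p + q).

Lemma idealM J f p : is_ideal J -> J p -> J (f * p).
Proof. by case=> J0 JP Jp; rewrite -[_ * _]addr0; apply: JP. Qed.

Lemma ideal_prod_power J y (L : seq 'rV[K]_m) : is_ideal J ->
    (forall a, a \in L -> exists N g, J (y ^+ N - g * linform a)) ->
  exists N g, J (y ^+ N - g * \prod_(a <- L) linform a).
Proof.
move=> iJ; elim: L => [|a L IHL] HL.
  by exists 0%N, 1; rewrite big_nil mulr1 expr0 subrr; case: iJ.
have [N1 [g1 H1]] := HL a (mem_head _ _).
have [|N2 [g2 H2]] := IHL; first by move=> b bL; apply: HL; rewrite inE bL orbT.
exists (N1 + N2)%N, (g1 * g2); rewrite big_cons; set P := \prod_(_ <- _) _ in H2 *.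
have -> : y ^+ (N1 + N2) - g1 * g2 * (linform a * P) =
    y ^+ N1 * (y ^+ N2 - g2 * P) + g2 * P * (y ^+ N1 - g1 * linform a).
  by rewrite exprD; ring.
by case: (iJ) => _; apply=> //; apply: idealM.
Qed.

(* A Nullstellensatz for products of linear forms: adjoin to the ideal the forms of
   a subspace [W], by induction on the codimension of [W]. *)
Lemma variable_power_in_ideal J (L : seq 'rV[K]_m) i : is_ideal J ->
    (forall x, x != 0 -> J (\prod_(a <- L | ~~ on_hyp a x) linform a)) ->
  exists N, J ('X_i ^+ N).
Proof.
move=> iJ HL; suff H c : forall J (W : 'M[K]_m), is_ideal J ->
    (forall x, x != 0 -> J (\prod_(a <- L | ~~ on_hyp a x) linform a)) ->
    (forall w, (w <= W)%MS -> J (linform w)) -> (m - \rank W <= c)%N ->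
  exists N, J ('X_i ^+ N).
  apply: (H m J 0) => // [w|]; last exact: leq_subr.
  by rewrite submx0 => /eqP ->; rewrite (eqP (_ : linform 0 == 0)) ?linform_eq0 //; case: iJ.
elim: c => [|c IHc] {}J W {}iJ {}HL HW rW; have [fW|nfW] := boolP (row_full W).
- by exists 1%N; rewrite expr1 -linform_delta; apply: HW; apply: submx_full.
- by case/negP: nfW; rewrite /row_full eqn_leq rank_leq_col -subn_eq0 -leqn0.
- by exists 1%N; rewrite expr1 -linform_delta; apply: HW; apply: submx_full.
(* All forms in [W] vanish at [x], so every form that is nonzero at [x] lies outside [W] and
   enlarges it. *)
have /rowV0Pn[x xW nzx] : kermx W^T != 0.
  rewrite kermx_eq0 /row_free mxrank_tr.
  by apply: contra nfW.
move/sub_kermxP: xW => xW.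
have [a aL|N [g HN]] := @ideal_prod_power J 'X_i [seq a <- L | ~~ on_hyp a x] iJ.
  move: aL; rewrite mem_filter => /andP[ax aL].
  have naW : ~~ (a <= W)%MS.
    apply: contra ax => /submxP[u ->].
    by rewrite /on_hyp trmx_mul mulmxA xW mul0mx.
  (* The ideal generated by [J] and [linform a], to which the induction hypothesis applies with
     [W + a]. *)
  pose Ja f := exists g, J (f - g * linform a).
  have JJa f : J f -> Ja f by exists 0; rewrite mul0r subr0.
  have iJa : is_ideal Ja.
    split=> [|f p q [g1 H1] [g2 H2]]; first by apply: JJa; case: iJ.
    exists (f * g1 + g2).
    have -> : f * p + q - (f * g1 + g2) * linform a =
      f * (p - g1 * linform a) + (q - g2 * linform a) by ring.
    by case: iJ => _; apply.
  have [|w||N [g HN]] := IHc Ja (W + a)%MS iJa.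
  - by move=> y nzy; apply: JJa; apply: HL.
  - case/sub_addsmxP=> -[u v] /= ->; exists ((v 0 0)%:MP).
    rewrite linformD (mx11_scalar v) mul_scalar_mx linformZ mul_mpolyC.
    rewrite -(mx11_scalar v) addrK.
    by apply: HW; apply: submxMl.
  - have lt : (\rank W < \rank (W + a)%MS)%N.
      apply: rank_ltmx; rewrite ltmxE addsmxSl /=.
      by apply: contra naW; apply: submx_trans; apply: addsmxSr.
    rewrite leq_subLR; move: rW; rewrite leq_subLR addnS -addSn => /leq_trans.
    by apply; rewrite leq_add2r.
  - by exists N, g.
exists N; move: HN; rewrite big_filter => HN.
rewrite -[_ ^+ _](subrK (g * \prod_(a <- L | ~~ on_hyp a x) linform a)).
rewrite addrC; case: iJ => _; apply=> //; exact: HL.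
Qed.

End PowersInIdeals.

Section RowVersions.
Variables (K : fieldType) (m r : nat).
Local Notation R := {mpoly K[m]}.
Implicit Types (u v c : 'rV[R]_r) (i j k : 'I_m).

Lemma monomial_cross_row i j N u v : i != j ->
  'X_i ^+ N *: u = 'X_j ^+ N *: v -> exists w, u = 'X_j ^+ N *: w.
Proof.
move=> ne /rowP E; have H l : exists p, u 0 l = 'X_j ^+ N * p.
  by move: (E l); rewrite !mxE => /(monomial_cross ne)[p [-> _]]; exists p.
have [p Ep] := fin_all_exists H; exists (\row_l p l).
by apply/rowP=> l; rewrite !mxE Ep.
Qed.

Lemma koszul_exact_row i j k N u v c : i != j -> i != k -> j != k ->
    'X_k ^+ N *: u - 'X_j ^+ N *: v + 'X_i ^+ N *: c = 0 ->
  exists qi qj qk : 'rV[R]_r, [/\ u = 'X_j ^+ N *: qi - 'X_i ^+ N *: qj,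
    v = 'X_k ^+ N *: qi - 'X_i ^+ N *: qk & c = 'X_k ^+ N *: qj - 'X_j ^+ N *: qk].
Proof.
move=> nij nik njk /rowP E.
have H l : exists q : R * R * R, [/\ u 0 l = 'X_j ^+ N * q.1.1 - 'X_i ^+ N * q.1.2,
    v 0 l = 'X_k ^+ N * q.1.1 - 'X_i ^+ N * q.2
  & c 0 l = 'X_k ^+ N * q.1.2 - 'X_j ^+ N * q.2].
  move: (E l); rewrite !mxE => /(koszul_exact nij nik njk)[q1 [q2 [q3 Q]]].
  by exists (q1, q2, q3).
have [q Eq] := fin_all_exists H.
exists (\row_l (q l).1.1), (\row_l (q l).1.2), (\row_l (q l).2).
by split; apply/rowP=> l; rewrite !mxE; have [E1 E2 E3] := Eq l.
Qed.

Lemma dvd_low_degree i N p d (q : R) :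
  (d < N)%N -> p \is d.-homog -> p = 'X_i ^+ N * q -> p = 0.
Proof.
move=> lt hp E; rewrite -(pihomog_dE hp) E mulrC.
rewrite (pihomogM _ _ (dhomogMn N (dhomogU K i))) /hshift mul1n leqNgt lt.
by rewrite mul0r.
Qed.

End RowVersions.

(** * Lifts obtained from local freeness along [H] *)

Section Lifting.
Variables (K : fieldType) (ell : nat).
Local Notation S := {mpoly K[ell.+1]}.
Local Notation R := {mpoly K[ell]}.
Local Notation wid := (widen_ord (leqnSn ell)).
Local Notation z := ('X_ord_max : S).
Local Notation rs := (map_mx (@res K ell)).
Variables (A : seq 'rV[K]_ell.+1) (aH : 'rV[K]_ell.+1).
Hypothesis nA : normal_arr A aH.
Hypothesis locfree : forall x : 'rV[K]_ell.+1, on_hyp aH x -> x != 0 ->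
  exists k (B : 'M[S]_(k, ell.+1)), is_basis (Dvec (loc_arr A x)) B.
Implicit Types (th t psi : 'rV[S]_ell) (e eta : 'rV[R]_ell).

Definition extend0 (x : 'rV[K]_ell) : 'rV[K]_ell.+1 :=
  \row_j oapp (fun i => x 0 i) 0 (unlift ord_max j).

Lemma extend0E x a : extend0 x *m a^T = x *m (bar a)^T.
Proof.
apply/matrixP=> i j; rewrite !mxE big_ord_recr /= !mxE unlift_none mul0r addr0.
by apply: eq_bigr => l _; rewrite !mxE widE liftK !ord1.
Qed.

(** Passing to the localization can only lower multiplicities, so [eta] stays admissible there and
    freeness lifts it. Multiplying by the forms off [x] moves the lift into [D0 A]. *)
Lemma local_mult_lift x eta : x != 0 -> Emod A aH eta ->
  exists2 th, D0 A th & rs th =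
    (\prod_(a <- map (@bar K ell) A | ~~ on_hyp a x) linform a) *: eta.
Proof.
move=> nzx Ee; pose x' := extend0 x.
have onE a : on_hyp a x' = on_hyp (bar a) x by rewrite /on_hyp extend0E.
have Hx' : on_hyp aH x' by rewrite onE (normal_bar nA) /on_hyp trmx0 mulmx0.
have nzx' : x' != 0.
  have [i xi] := neq0_coord nzx; apply/rV0Pn; exists (lift ord_max i).
  by rewrite mxE liftK.
have [k [B bB]] := locfree Hx' nzx'.
have nAx : normal_arr (loc_arr A x') aH by apply: normal_filter.
have Eex : Emod (loc_arr A x') aH eta.
  move=> a; rewrite !mem_filter => /and3P[ne ax aA].
  have aD : a \in deleted A aH by rewrite mem_deleted ne.
  apply: pdvd_trans (Ee a aD); apply: pdvd_exp; rewrite /zmult !count_filter.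
  by apply: sub_count => b /= /andP[/andP[-> ->]].
have [th Dth resth] := res_D0_surj nAx bB Eex.
exists ((\prod_(b <- A | ~~ on_hyp b x') linform b) *: th).
  apply: (D0_scale_prod (p := fun b => on_hyp b x')) => b bA bx.
  by apply: Dth; rewrite mem_filter bx.
rewrite map_resZ resth; congr (_ *: _); rewrite rmorph_prod big_map.
by apply: eq_big => [b|b _] /=; rewrite ?onE ?res_linform.
Qed.

(** The polynomials [f] for which [f *: eta] lifts form an ideal. By the local lifts it satisfies
    the hypothesis of [variable_power_in_ideal]. *)
Lemma power_lift i eta : Emod A aH eta ->
  exists N, forall M, (N <= M)%N ->
    exists2 th, D0 A th & rs th = 'X_i ^+ M *: eta.
Proof.
move=> Ee; pose J f := exists2 th, D0 A th & rs th = f *: eta.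
have iJ : is_ideal J.
  split=> [|f p q [t1 D1 E1] [t2 D2 E2]].
    by exists 0; [apply: (submod0 (submod_D0 A)) | rewrite map_mx0 scale0r].
  exists (mwiden f *: t1 + t2); first exact: (proj2 (submod_D0 A)).
  by rewrite map_mxD map_resZ mwidenK E1 E2 scalerA scalerDl.
have [x nzx|N JN] := variable_power_in_ideal (L := map (@bar K ell) A) i iJ.
  exact: local_mult_lift.
exists N => M le; rewrite -(subnK le) exprD.
exact: (idealM _ iJ JN).
Qed.

Local Notation X i := ('X_(wid i) : S).

Lemma resX i N : res (X i ^+ N) = 'X_i ^+ N.
Proof. by rewrite rmorphXn /= resU. Qed.

Lemma D0_comb f g t1 t2 : D0 A t1 -> D0 A t2 -> D0 A (f *: t1 - g *: t2).
Proof.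
by move=> D1 D2; apply: (submodB (submod_D0 A)); apply: (submodZ (submod_D0 A)).
Qed.

Lemma scalez_inj k (u v : 'rV[S]_ell) : z ^+ k *: u = z ^+ k *: v -> u = v.
Proof.
move=> E; apply: subr0_eq.
apply: (scalemx_domain_eq0 (p := z ^+ k)); first exact/expf_neq0/mpolyU_neq0.
by rewrite scalerBr E subrr.
Qed.

(** The error [psi] restricts to a Koszul coboundary of [e1] and [e2]. These need not lift, but
    their multiples by [M]-th powers do; subtracting those lifts makes the new error vanish on
    [z = 0], which gains one factor [z]. *)
Lemma correction_step k N M i j t1 t2 psi ep1 ep2 e1 e2 :
    D0 A psi -> D0 A ep1 -> D0 A ep2 ->
    X j ^+ N *: t1 - X i ^+ N *: t2 = z ^+ k.+1 *: psi ->
    rs psi = 'X_j ^+ N *: e1 - 'X_i ^+ N *: e2 ->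
    rs ep1 = 'X_i ^+ M *: e1 -> rs ep2 = 'X_j ^+ M *: e2 ->
  exists2 psi', D0 A psi' &
    X j ^+ (N + M) *: (X i ^+ M *: t1 - z ^+ k.+1 *: ep1)
      - X i ^+ (N + M) *: (X j ^+ M *: t2 - z ^+ k.+1 *: ep2) = z ^+ k.+2 *: psi'.
Proof.
move=> Dp D1 D2 E Ep E1 E2.
pose w := (X i ^+ M * X j ^+ M) *: psi
  - (X j ^+ (N + M) *: ep1 - X i ^+ (N + M) *: ep2).
have [||psi' Dpsi' Ew] := @D0_ker _ _ _ _ nA w.
- apply: (submodB (submod_D0 A)); last exact: D0_comb.
  exact: (submodZ (submod_D0 A)).
- rewrite map_mxB map_resZ map_mxB !map_resZ rmorphM /= !resX Ep E1 E2.
  by apply/rowP=> l; rewrite !mxE !exprD; ring.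
exists psi' => //; rewrite [z ^+ k.+2]exprSr -scalerA -Ew /w.
move/rowP: E => E; apply/rowP=> l; move: (E l); rewrite !mxE !exprD => El.
transitivity (X i ^+ M * X j ^+ M * (z ^+ k.+1 * psi 0 l)
  - z ^+ k.+1 * (X j ^+ N * X j ^+ M * ep1 0 l - X i ^+ N * X i ^+ M * ep2 0 l)).
  by rewrite -El; ring.
by ring.
Qed.

Lemma cancel_coboundary (x1 x2 y : S) (u v p e f : 'rV[S]_ell) :
    x2 *: u - x1 *: v = y *: p -> p = x2 *: e - x1 *: f ->
  x2 *: (u - y *: e) = x1 *: (v - y *: f).
Proof.
move=> E Ep; rewrite Ep in E; move/rowP: E => E; apply/rowP=> l; move: (E l).
rewrite !mxE => El; apply: subr0_eq.
transitivity (x2 * u 0 l - x1 * v 0 l - y * (x2 * e 0 l - x1 * f 0 l)); first by ring.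
by rewrite El subrr.
Qed.

(** * Koszul cocycles in three variables *)

Section ThreeVariables.
Variables i1 i2 i3 : 'I_ell.
Hypotheses (n12 : i1 != i2) (n13 : i1 != i3) (n23 : i2 != i3).

Lemma wid_neq (i j : 'I_ell) : i != j -> wid i != wid j.
Proof. by apply: contra => /eqP/(congr1 val)/= E; apply/eqP/val_inj. Qed.

Lemma cocycle k N t1 t2 t3 p12 p13 p23 :
    X i2 ^+ N *: t1 - X i1 ^+ N *: t2 = z ^+ k *: p12 ->
    X i3 ^+ N *: t1 - X i1 ^+ N *: t3 = z ^+ k *: p13 ->
    X i3 ^+ N *: t2 - X i2 ^+ N *: t3 = z ^+ k *: p23 ->
  X i3 ^+ N *: p12 - X i2 ^+ N *: p13 + X i1 ^+ N *: p23 = 0.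
Proof.
move=> /rowP E12 /rowP E13 /rowP E23; apply: (@scalez_inj k); rewrite scaler0.
apply/rowP=> l; move: (E12 l) (E13 l) (E23 l); rewrite !mxE => e12 e13 e23.
transitivity (X i3 ^+ N * (z ^+ k * p12 0 l) - X i2 ^+ N * (z ^+ k * p13 0 l)
  + X i1 ^+ N * (z ^+ k * p23 0 l)); first by ring.
by rewrite -e12 -e13 -e23; ring.
Qed.

(** The fractions [ti / x_i^N] are lifts of [eta] that agree up to order [z^k], with errors in [D0].
    A positive [N] leaves room for elements of degree [N - 1] in the final degree argument. *)
Definition approx_lift eta k := exists N t1 t2 t3 p12 p13 p23,
  [/\ (0 < N)%N, [/\ D0 A t1, D0 A t2 & D0 A t3], [/\ D0 A p12, D0 A p13 & D0 A p23],
   [/\ rs t1 = 'X_i1 ^+ N *: eta, rs t2 = 'X_i2 ^+ N *: eta & rs t3 = 'X_i3 ^+ N *: eta]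
 & [/\ X i2 ^+ N *: t1 - X i1 ^+ N *: t2 = z ^+ k *: p12,
       X i3 ^+ N *: t1 - X i1 ^+ N *: t3 = z ^+ k *: p13
     & X i3 ^+ N *: t2 - X i2 ^+ N *: t3 = z ^+ k *: p23]].

Lemma approx_lift1 eta : Emod A aH eta -> approx_lift eta 1.
Proof.
move=> Ee.
have [N1 H1] := power_lift i1 Ee; have [N2 H2] := power_lift i2 Ee.
have [N3 H3] := power_lift i3 Ee; pose N := (N1 + N2 + N3).+1.
have le1 : (N1 <= N)%N by rewrite /N -addnA leqW // leq_addr.
have le2 : (N2 <= N)%N by rewrite /N leqW // -addnA addnCA leq_addr.
have le3 : (N3 <= N)%N by rewrite /N leqW // leq_addl.
have [t1 D1 E1] := H1 N le1; have [t2 D2 E2] := H2 N le2; have [t3 D3 E3] := H3 N le3.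
have diff i j ti tj : D0 A ti -> D0 A tj -> rs ti = 'X_i ^+ N *: eta ->
    rs tj = 'X_j ^+ N *: eta ->
  exists2 p, D0 A p & X j ^+ N *: ti - X i ^+ N *: tj = z ^+ 1 *: p.
  move=> Di Dj Ei Ej; apply: (D0_ker nA); first exact: D0_comb.
  by rewrite map_mxB !map_resZ !resX Ei Ej !scalerA mulrC subrr.
have [p12 Dp12 Ep12] := diff _ _ _ _ D1 D2 E1 E2.
have [p13 Dp13 Ep13] := diff _ _ _ _ D1 D3 E1 E3.
have [p23 Dp23 Ep23] := diff _ _ _ _ D2 D3 E2 E3.
by exists N, t1, t2, t3, p12, p13, p23.
Qed.

Variables (r : nat) (EB : 'M[R]_(r, ell)).
Hypothesis bEB : is_basis (Emod A aH) EB.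

(** The restricted errors form a Koszul cocycle. Independence of [EB] transfers it to the
    coefficients, where exactness makes it a coboundary; the resulting potentials lie in [Emod] and
    feed [correction_step]. *)
Lemma approx_lift_step eta k : approx_lift eta k.+1 -> approx_lift eta k.+2.
Proof.
case=> N [t1 [t2 [t3 [p12 [p13 [p23 [N0 [D1 D2 D3] [Dp12 Dp13 Dp23] [E1 E2 E3]]]]]]]].
case=> [Ep12 Ep13 Ep23]; have [DE indE genE] := bEB.
have [c12 Ec12] := genE _ (res_D0 nA Dp12).
have [c13 Ec13] := genE _ (res_D0 nA Dp13).
have [c23 Ec23] := genE _ (res_D0 nA Dp23).
have /(congr1 rs) := cocycle Ep12 Ep13 Ep23.
rewrite map_mxD map_mxB !map_resZ !resX map_mx0 Ec12 Ec13 Ec23 !scalemxAl.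
rewrite -mulmxBl -mulmxDl => /indE /(koszul_exact_row n12 n13 n23).
case=> q1 [q2 [q3 [Q12 Q13 Q23]]].
have EE q : Emod A aH (q *m EB) by apply: (submod_mul (submod_Emod A aH)).
have [N1 H1] := power_lift i1 (EE q1); have [N2 H2] := power_lift i2 (EE q2).
have [N3 H3] := power_lift i3 (EE q3); pose M := (N1 + N2 + N3)%N.
have le1 : (N1 <= M)%N by rewrite /M -addnA leq_addr.
have le2 : (N2 <= M)%N by rewrite /M -addnA addnCA leq_addr.
have le3 : (N3 <= M)%N by rewrite /M leq_addl.
have [s1 F1 G1] := H1 M le1; have [s2 F2 G2] := H2 M le2; have [s3 F3 G3] := H3 M le3.
rewrite Q12 mulmxBl -!scalemxAl in Ec12.
rewrite Q13 mulmxBl -!scalemxAl in Ec13.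
rewrite Q23 mulmxBl -!scalemxAl in Ec23.
have [p12' Dp12' Ep12'] := correction_step Dp12 F1 F2 Ep12 Ec12 G1 G2.
have [p13' Dp13' Ep13'] := correction_step Dp13 F1 F3 Ep13 Ec13 G1 G3.
have [p23' Dp23' Ep23'] := correction_step Dp23 F2 F3 Ep23 Ec23 G2 G3.
have rsE i ti si : rs ti = 'X_i ^+ N *: eta ->
    rs (X i ^+ M *: ti - z ^+ k.+1 *: si) = 'X_i ^+ (N + M) *: eta.
  move=> Ei; rewrite map_mxB !map_resZ resX Ei rmorphXn /= res_last expr0n /=.
  by rewrite scale0r subr0 scalerA exprD mulrC.
exists (N + M)%N, (X i1 ^+ M *: t1 - z ^+ k.+1 *: s1),
  (X i2 ^+ M *: t2 - z ^+ k.+1 *: s2), (X i3 ^+ M *: t3 - z ^+ k.+1 *: s3),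
  p12', p13', p23'; split=> //; first by rewrite addn_gt0 N0.
- by split; apply: D0_comb.
- by split; apply: rsE.
Qed.

Lemma approx_lift_all eta k : Emod A aH eta -> approx_lift eta k.+1.
Proof.
move=> Ee; elim: k => [|k IHk]; first exact: approx_lift1.
exact: approx_lift_step.
Qed.

Lemma hcompXZ q (i : 'I_ell.+1) N d (G : 'M[S]_(q, ell)) :
  hcomp (d + N) ('X_i ^+ N *: G) = 'X_i ^+ N *: hcomp d G.
Proof.
rewrite (hcompZ _ _ (dhomogMn N (dhomogU K i))) mul1n leq_addl addnK //.
Qed.

(** At order [d + 1] the Koszul potentials of the errors have degree below the exponent of the
    variables, which forces them into [D0]. Subtracting them makes the corrected [t1] divisible by
    the power of the first variable, and the quotient lifts [eta]. *)
Lemma approx_lift_homog eta d : Emod A aH eta -> homog_mx eta (fun=> d) ->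
  exists2 th, D0 A th & rs th = eta.
Proof.
move=> Ee heta.
have [N [t1 [t2 [t3 [p12 [p13 [p23 []]]]]]]] := approx_lift_all d Ee.
case: N => // N _ [D1 D2 D3] [Dp12 Dp13 Dp23] [E1 E2 E3] [Ep12 Ep13 Ep23].
(* The [ti] lift elements of degree [d + N.+1], so the other components are dropped. The errors then
   have degree [N + N.+1] after division by [z ^+ d.+1], and their potentials have degree [N]. *)
pose comp_t := hcomp (d + N.+1) : 'rV[S]_ell -> 'rV[S]_ell.
pose comp_p := hcomp (N + N.+1) : 'rV[S]_ell -> 'rV[S]_ell.
have compE i j u v w : X j ^+ N.+1 *: u - X i ^+ N.+1 *: v = z ^+ d.+1 *: w ->
    X j ^+ N.+1 *: comp_t u - X i ^+ N.+1 *: comp_t v = z ^+ d.+1 *: comp_p w.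
  move/(congr1 (hcomp (d + N.+1 + N.+1))); rewrite hcompB !hcompXZ => ->.
  have -> : (d + N.+1 + N.+1 = N + N.+1 + d.+1)%N by lia.
  by rewrite hcompXZ.
have {}Ep12 := compE _ _ _ _ _ Ep12; have {}Ep13 := compE _ _ _ _ _ Ep13.
have {}Ep23 := compE _ _ _ _ _ Ep23; have gD := graded_D0 (A := A).
have := cocycle Ep12 Ep13 Ep23.
move/(koszul_exact_row (wid_neq n12) (wid_neq n13) (wid_neq n23)).
case=> e1 [e2 [_ [Q12 _ _]]].
have {}Q12 : comp_p p12 = X i2 ^+ N.+1 *: hcomp N e1 - X i1 ^+ N.+1 *: hcomp N e2.
  have := congr1 comp_p Q12; rewrite /comp_p hcompB !hcompXZ => <-.
  by rewrite (hcomp_id (homog_hcomp _ _)).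
have nX a i : a \in deleted A aH -> ~ pdvd (linform a) (X i ^+ N.+1).
  rewrite mem_deleted => /andP[_ aA].
  rewrite (elim_varP (normal_last nA aA)) rmorphXn /= elim_varU.
    by apply/eqP; apply/expf_neq0/mpolyU_neq0.
  by rewrite widE eq_sym neq_lift.
(* Modulo [linform a] the value of [p12] vanishes, so by coprimality the value of each potential is
   divisible by an [N.+1]-st power of a variable. Being of degree [N], it is zero. *)
have De a : a \in deleted A aH -> pdvd (linform a) (lapp (bar a) (hcomp N e1)) /\
    pdvd (linform a) (lapp (bar a) (hcomp N e2)).
  rewrite mem_deleted => /andP[_ aA]; have al := normal_last nA aA.
  have : pdvd (linform a) (lapp (bar a) (comp_p p12)) by apply: (gD _ _ Dp12).
  rewrite !(elim_varP al) Q12 lappB !lappZ rmorphB !rmorphM !rmorphXn /=.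
  rewrite !elim_varU ?widE ?(eq_sym _ ord_max) ?neq_lift // -!widE.
  move/subr0_eq => Ea; have nw := wid_neq n12; have nw' : wid i2 != wid i1 by rewrite eq_sym.
  have he (e : 'rV[S]_ell) : elim_var a ord_max (lapp (bar a) (hcomp N e)) \is N.-homog.
    by apply: dhomog_elim_var; rewrite lapp_hcomp; apply: pihomogP.
  have [q [F1 F2]] := monomial_cross nw' Ea.
  by split; [apply: dvd_low_degree (he e1) F1 | apply: dvd_low_degree (he e2) F2].
have De1 : D0 A (hcomp N e1).
  move=> a aA; case: (eqVneq a aH) => [->|ne].
    by rewrite (normal_bar nA) lapp0l; apply: pdvd0.
  by case: (De a); rewrite ?mem_deleted ?ne.
have D1' : D0 A (comp_t t1 - z ^+ d.+1 *: hcomp N e1).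
  by apply: (submodB (submod_D0 A)); [apply: gD | apply: (submodZ (submod_D0 A))].
(* The corrected [t1] and [t2] satisfy the exact cross relation, and powers of distinct variables
   are coprime. *)
have [th Eth] : exists th, comp_t t1 - z ^+ d.+1 *: hcomp N e1 = X i1 ^+ N.+1 *: th.
  apply: (@monomial_cross_row _ _ _ (wid i2) (wid i1) N.+1 _
    (comp_t t2 - z ^+ d.+1 *: hcomp N e2)); first by rewrite eq_sym wid_neq.
  exact: cancel_coboundary Ep12 Q12.
exists th; first by apply: (@D0_cancel _ _ _ _ nA (X i1 ^+ N.+1)); [move=> a /nX | rewrite -Eth].
have := congr1 rs Eth; rewrite map_mxB !map_resZ resX rmorphXn /= res_last.
rewrite expr0n /= scale0r subr0 map_res_hcomp E1.
rewrite (hcompZ _ _ (dhomogMn _ (dhomogU K i1))) mul1n leq_addl addnK hcomp_id //.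
move=> F; apply: subr0_eq; apply: (scalemx_domain_eq0 (p := 'X_i1 ^+ N.+1)).
  exact/expf_neq0/mpolyU_neq0.
by rewrite scalerBr -F subrr.
Qed.

End ThreeVariables.

Lemma zpower_eq0 (p : S) : (forall k, exists q, p = z ^+ k * q) -> p = 0.
Proof.
move=> H; have [q E] := H (msize p).
rewrite (@pihomog_partitionE _ _ mdeg _ p (leqnn _)) big1 // => d _.
rewrite [p in pihomog _ _ p]E mulrC (pihomogM _ _ (dhomogMn _ (dhomogU K _))).
by rewrite /hshift mul1n leqNgt ltn_ord mul0r.
Qed.

(** Lifts of a homogeneous basis are taken in the same degrees. A relation among them can be divided
    by [z] indefinitely, hence is zero; every element of [D0] is a combination of them up to an
    arbitrarily high power of [z]. *)
Lemma D0_basis_of_Emod k (EB : 'M[R]_(k, ell)) : (3 <= ell)%N ->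
  is_basis (Emod A aH) EB -> exists G : 'M[S]_(k, ell), is_basis (D0 A) G.
Proof.
move=> ell3 bEB0.
have [EB' [ds [hE bE]]] := homog_basis (submod_Emod A aH) (graded_Emod (A := A) (aH := aH)) bEB0.
have [DE indE genE] := bE.
have H (j : 'I_k) : exists th, D0 A th /\ rs th = row j EB'.
  have lt0 : (0 < ell)%N by apply: leq_trans ell3.
  have lt1 : (1 < ell)%N by apply: leq_trans ell3.
  have [||||th Dth Eth] := @approx_lift_homog (Ordinal lt0) (Ordinal lt1) (Ordinal ell3)
    _ _ _ _ _ bEB0 (row j EB') (ds j) (DE j).
  - by [].
  - by [].
  - by [].
  - by move=> i l; rewrite mxE; apply: hE.
  - by exists th.
have [th Hth] := fin_all_exists H.
pose G := \matrix_(j < k) hcomp (ds j) (th j).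
have DG j : D0 A (row j G) by rewrite rowK; apply: graded_D0; case: (Hth j).
have hG : homog_mx G ds by move=> i j; rewrite mxE; apply: homog_hcomp.
have rG : rs G = EB'.
  apply/row_matrixP=> j; rewrite -map_row rowK map_res_hcomp; have [_ ->] := Hth j.
  by rewrite hcomp_id // => i l; rewrite mxE; apply: hE.
exists G; split=> // [c cG|t Dt].
  have Hs s : exists2 c', c' *m G = 0 & c = z ^+ s *: c'.
    elim: s => [|s [c' c'G Ec]]; first by exists c; rewrite ?expr0 ?scale1r.
    have /indE/map_res_eq0[c'' Ec'] : rs c' *m EB' = 0.
      by rewrite -rG -map_mxM c'G map_mx0.
    exists c''; last by rewrite exprSr -scalerA -Ec'.
    apply: (scalemx_domain_eq0 (p := z)); first exact: mpolyU_neq0.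
    by rewrite scalemxAl -Ec'.
  apply/rowP=> j; rewrite mxE; apply: zpower_eq0 => s.
  by have [c' _ ->] := Hs s; exists (c' 0 j); rewrite mxE.
have Hs s u : D0 A u -> exists c u', D0 A u' /\ u = c *m G + z ^+ s *: u'.
  move=> Du; elim: s => [|s [c [u' [Du' Eu]]]].
    by exists 0, u; rewrite mul0mx add0r expr0 scale1r.
  have [c' Ec'] := genE _ (res_D0 nA Du').
  have [||u'' Du'' Eu''] := @D0_ker _ _ _ _ nA (u' - map_mx (@mwiden ell K) c' *m G).
  - by apply: (submodB (submod_D0 A)) => //; apply: (submod_mul (submod_D0 A)).
  - by rewrite map_mxB map_mxM map_mwidenK rG Ec' subrr.
  exists (c + z ^+ s *: map_mx (@mwiden ell K) c'), u''; split=> //.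
  rewrite Eu exprSr -scalerA -Eu'' mulmxDl -scalemxAl scalerBr -addrA.
  by congr (_ + _); rewrite addrC subrK.
have [N ->] := sum_hcomp t; apply: span_sum => d.
(* With exponent [d.+1] the remainder has no component in degree [d]. *)
have [c [u' [_ E]]] := Hs d.+1 _ (graded_D0 (A := A) d Dt).
have := congr1 (hcomp d) E; rewrite hcompD (hcomp_mul _ _ hG).
rewrite (hcomp_id (homog_hcomp _ _)) (hcompZ _ _ (dhomogMn _ (dhomogU K _))).
by rewrite mul1n ltnn addr0 => ->; eexists.
Qed.

End Lifting.

(** * Localization and coordinate changes *)

Lemma free_der_moduleP (K : fieldType) m (Q : der K m -> Prop)
    (P : 'rV[{mpoly K[m]}]_m -> Prop) :
    (forall d : der K m, Q d <-> P (\row_i d i)) ->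
  free_der_module Q <-> exists k (B : 'M_(k, m)), is_basis P B.
Proof.
move=> QP; split=> [[k [b [Qb [indb genb]]]]|[k [B [PB indB genB]]]].
  exists k, (\matrix_(j, i) b j i); split=> [j|c cB|v Pv].
  - have -> : row j (\matrix_(j, i) b j i) = \row_i b j i by apply/rowP=> i; rewrite !mxE.
    exact/QP.
  - apply/rowP=> j; rewrite mxE; apply: (indb (fun j => c 0 j)) => i.
    move/rowP/(_ i): cB; rewrite !mxE => E; rewrite -[RHS]E.
    by apply: eq_bigr => l _; rewrite mxE.
  - have /genb[c Ec] : Q (fun i => v 0 i).
      by apply/QP; have -> : \row_i v 0 i = v by apply/rowP=> i; rewrite mxE.
    exists (\row_j c j); apply/rowP=> i; rewrite Ec mxE.
    by apply: eq_bigr => l _; rewrite !mxE.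
exists k, (fun j i => B j i); split=> [j|].
  by apply/QP; have -> : \row_i B j i = row j B by apply/rowP=> i; rewrite !mxE.
split=> [c Hc j|d /QP/genB[c Ec]].
  have /rowP/(_ j) : \row_j c j = 0; last by rewrite !mxE.
  apply: indB; apply/rowP=> i; rewrite !mxE -[RHS](Hc i).
  by apply: eq_bigr => l _; rewrite mxE.
by exists (fun j => c 0 j) => i; move/rowP/(_ i): Ec; rewrite !mxE.
Qed.

Lemma free_arrP (K : fieldType) n (A : seq 'rV[K]_n) :
  free_arr A <-> exists k (B : 'M_(k, n)), is_basis (Dvec A) B.
Proof.
apply: free_der_moduleP => d.
have E a : der_app d (linform a) = lapp a (\row_i d i).
  by rewrite der_app_linform; apply: eq_bigr => i _; rewrite mxE.
by split=> H a aA; move: (H a aA); rewrite E.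
Qed.

Section Localization.
Variables (K : fieldType) (n : nat).
Local Notation S := {mpoly K[n]}.
Implicit Types (a x : 'rV[K]_n).

Lemma on_hypE a x : on_hyp a x = (\sum_i a 0 i * x 0 i == 0).
Proof.
rewrite /on_hyp; have -> : x *m a^T = (\sum_i a 0 i * x 0 i)%:M.
  rewrite [LHS]mx11_scalar; congr _%:M; rewrite mxE.
  by apply: eq_bigr => i _; rewrite mxE mulrC.
apply/eqP/eqP => [/matrixP/(_ 0 0)|->]; first by rewrite !mxE eqxx mulr1n.
exact: raddf0.
Qed.

Definition shift_tuple x : n.-tuple S := [tuple 'X_i + (x 0 i)%:MP | i < n].

Definition shift x : S -> S := comp_mpoly (shift_tuple x).

HB.instance Definition _ x := GRing.RMorphism.copy (shift x)
  (comp_mpoly (shift_tuple x)).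

Lemma shiftZ x c p : shift x (c *: p) = c *: shift x p.
Proof. exact: comp_mpolyZ. Qed.

Lemma shiftU x i : shift x 'X_i = 'X_i + (x 0 i)%:MP.
Proof. by rewrite /shift comp_mpolyXU -tnth_nth tnth_mktuple. Qed.

Lemma shiftK x : cancel (shift (- x)) (shift x).
Proof.
apply: (@mpoly_hom_ext K n _ (shift x \o shift (- x)) idfun) => [c|i] /=.
  by rewrite /shift !comp_mpolyC.
by rewrite shiftU rmorphD /= shiftU /shift comp_mpolyC mxE mpolyCN addrK.
Qed.

Lemma shift_linform x a :
  shift x (linform a) = linform a + (\sum_i a 0 i * x 0 i)%:MP.
Proof.
rewrite /linform !raddf_sum -big_split; apply: eq_bigr => i _ /=.
by rewrite shiftZ shiftU scalerDr mpolyCM mul_mpolyC.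
Qed.

Lemma shift_on_hyp x a : on_hyp a x -> shift x (linform a) = linform a.
Proof. by rewrite on_hypE shift_linform => /eqP ->; rewrite addr0. Qed.

Lemma lapp_shift x a v : shift x (lapp a v) = lapp a (map_mx (shift x) v).
Proof. exact: (@lapp_map _ _ _ _ (shift x) a v (shiftZ x)). Qed.

(** Forms of the localization vanish at [y], hence are fixed by translation by [y]. *)
Lemma Dvec_shift A x y v : (forall a, on_hyp a x -> on_hyp a y) ->
  Dvec (loc_arr A x) v -> Dvec (loc_arr A x) (map_mx (shift y) v).
Proof.
move=> xy Dv a aA; rewrite -lapp_shift; have [r ->] := Dv a aA.
move: aA; rewrite mem_filter => /andP[/xy/shift_on_hyp E _].
by exists (shift y r); rewrite rmorphM /= E.
Qed.

Lemma Dvec_filter_scale A (p : pred 'rV[K]_n) v : Dvec (filter p A) v ->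
  Dvec A ((\prod_(b <- A | ~~ p b) linform b) *: v).
Proof.
move=> Dv b bA; rewrite lappZ; case: (boolP (p b)) => pb.
  by apply: pdvd_mull; apply: Dv; rewrite mem_filter pb.
apply: pdvd_mulr; rewrite (perm_big _ (perm_to_rem bA)) big_cons pb.
exact/pdvd_mulr/pdvd_refl.
Qed.

(* Translation by [x] preserves [A_x], and the forms of [A] off [x] become units at
   the origin: a basis of [D(A)] translates to a basis of [D(A_x)] near [0]. *)
Lemma localization_basis A x k (B : 'M[S]_(k, n)) : is_basis (Dvec A) B ->
  exists k (B : 'M[S]_(k, n)), is_basis (Dvec (loc_arr A x)) B.
Proof.
case=> DB indB genB.
have t't : cancel (shift x) (shift (- x)) by move=> p; rewrite -{2}[x]opprK shiftK.
have tt' := shiftK x.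
have DB' i : Dvec (loc_arr A x) (row i (map_mx (shift x) B)).
  rewrite -map_row; apply: Dvec_shift => // a; rewrite mem_filter => /andP[_].
  exact: DB.
pose q0 := \prod_(b <- A | ~~ on_hyp b x) linform b.
have indB' (c : 'rV_k) : c *m map_mx (shift x) B = 0 -> c = 0.
  move/(congr1 (map_mx (shift (- x)))); rewrite map_mxM map_mx0.
  have -> : map_mx (shift (- x)) (map_mx (shift x) B) = B by apply/matrixP=> i j; rewrite !mxE t't.
  move/indB/(congr1 (map_mx (shift x))); rewrite map_mx0 => <-.
  by apply/matrixP=> i j; rewrite !mxE tt'.
(* The constant term after translation is the product of the values at [x] of the forms off [x]. *)
have q00 : (shift x q0)@_0%MM != 0.
  pose c0 : {rmorphism S -> K} := mcoeff (0%MM : 'X_{1..n}).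
  rewrite -[_@__]/(c0 (shift x q0)) /q0 !rmorph_prod prodf_seq_neq0.
  apply/allP=> b _; apply/implyP; rewrite on_hypE /= shift_linform.
  rewrite mcoeffD mcoeffC eqxx mulr1.
  by rewrite (dhomog_nemf_coeff (dhomog_linform b)) /= ?mdeg0 // add0r.
have genB' v : Dvec (loc_arr A x) v -> exists c : 'rV_k, shift x q0 *: v = c *m map_mx (shift x) B.
  move=> Dv; have [|c Ec] := genB (q0 *: map_mx (shift (- x)) v).
    apply: Dvec_filter_scale; apply: Dvec_shift => // a; rewrite !on_hypE => /eqP E.
    rewrite (eq_bigr (fun i => - (a 0 i * x 0 i))) ?sumrN ?E ?oppr0 // => i _.
    by rewrite mxE mulrN.
  exists (map_mx (shift x) c); rewrite -map_mxM -Ec; apply/matrixP=> i j.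
  by rewrite !mxE rmorphM /= tt'.
have gD := graded_Dvec (A := loc_arr A x).
have [r [G [ds [L [DG hG defB]]]]] := homog_generators gD DB'.
have [f [_ bf]] :=
  homog_basis_exchange (submod_Dvec (loc_arr A x)) gD DG hG indB' q00 genB' defB.
by exists k, (rowsub f G).
Qed.

End Localization.

Section CoordinateChange.
Variables (K : fieldType) (n : nat).
Local Notation S := {mpoly K[n]}.
Local Notation C := (map_mx (@mpolyC n K)).
Implicit Types (a : 'rV[K]_n) (g h : 'M[K]_n).

Definition subst_tuple g : n.-tuple S := [tuple linform (row i g) | i < n].

Definition lsubst g : S -> S := comp_mpoly (subst_tuple g).

HB.instance Definition _ g := GRing.RMorphism.copy (lsubst g)
  (comp_mpoly (subst_tuple g)).

Lemma lsubstZ g c p : lsubst g (c *: p) = c *: lsubst g p.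
Proof. exact: comp_mpolyZ. Qed.

Lemma lsubst_linform g a : lsubst g (linform a) = linform (a *m g).
Proof.
rewrite mulmx_sum_row {1}/linform raddf_sum.
rewrite (big_morph (@linform K n) (@linformD K n) (id1 := 0)); last first.
  by apply/eqP; rewrite linform_eq0.
apply: eq_bigr => i _; rewrite /= lsubstZ linformZ; congr (_ *: _).
by rewrite /lsubst comp_mpolyXU -tnth_nth tnth_mktuple.
Qed.

Lemma lsubstK g h : g *m h = 1%:M -> cancel (lsubst g) (lsubst h).
Proof.
move=> gh; apply: (@mpoly_hom_ext K n _ (lsubst h \o lsubst g) idfun) => [c|i] /=.
  by rewrite /lsubst !comp_mpolyC.
by rewrite -linform_delta !lsubst_linform -mulmxA gh mulmx1.
Qed.

Lemma lapp_mulC g a (v : 'rV[S]_n) : lapp a (v *m C g^T) = lapp (a *m g) v.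
Proof.
rewrite /lapp (eq_bigr (fun i => \sum_j (a 0 i * g i j) *: v 0 j)).
  rewrite exchange_big; apply: eq_bigr => j _; rewrite mxE scaler_suml.
  by apply: eq_bigr.
move=> i _; rewrite mxE scaler_sumr; apply: eq_bigr => j _.
by rewrite !mxE mulrC mul_mpolyC scalerA.
Qed.

Lemma lapp_lsubst g a (v : 'rV[S]_n) :
  lsubst g (lapp a v) = lapp a (map_mx (lsubst g) v).
Proof. exact: (@lapp_map _ _ _ _ (lsubst g) a v (lsubstZ g)). Qed.

(** The substitution acts on the coefficients and the inverse transpose on the coordinate values, so
    that the new derivation takes at [a *m g] the substituted value of the old one at [a]. *)
Lemma basis_lsubst (A : seq 'rV[K]_n) g k (B : 'M[S]_(k, n)) :
    g \in unitmx -> is_basis (Dvec A) B ->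
  exists k (B : 'M[S]_(k, n)), is_basis (Dvec [seq a *m g | a <- A]) B.
Proof.
move=> ug [DB indB genB]; pose h := invmx g; pose s := lsubst g; pose s' := lsubst h.
have s's : cancel s s' by apply: lsubstK; rewrite mulmxV.
have ss' : cancel s' s by apply: lsubstK; rewrite mulVmx.
have Chg : C h^T *m C g^T = 1%:M.
  by rewrite -map_mxM -trmx_mul mulmxV // trmx1 map_mx1.
have Cgh : C g^T *m C h^T = 1%:M.
  by rewrite -map_mxM -trmx_mul mulVmx // trmx1 map_mx1.
exists k, (map_mx s B *m C h^T); split=> [i|c|v Dv].
- move=> _ /mapP[a aA ->]; rewrite row_mul lapp_mulC -mulmxA mulmxV // mulmx1.
  rewrite -map_row -lapp_lsubst -lsubst_linform.
  by have [r ->] := DB i a aA; exists (s r); rewrite rmorphM.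
- rewrite mulmxA => /(congr1 (mulmx^~ (C g^T))).
  rewrite -mulmxA Chg mulmx1 mul0mx => /(congr1 (map_mx s')).
  rewrite map_mxM map_mx0.
  have -> : map_mx s' (map_mx s B) = B by apply/matrixP=> i j; rewrite !mxE s's.
  move/indB/(congr1 (map_mx s)); rewrite map_mx0 => <-.
  by apply/matrixP=> i j; rewrite !mxE ss'.
- have [a aA|c Ec] := genB (map_mx s' (v *m C g^T)).
    rewrite -lapp_lsubst lapp_mulC; have [r ->] := Dv _ (map_f (mulmx^~ g) aA).
    exists (s' r); rewrite rmorphM /= -lsubst_linform; congr (_ * _).
    exact: s's.
  exists (map_mx s c); rewrite mulmxA -map_mxM -Ec.
  have -> : map_mx s (map_mx s' (v *m C g^T)) = v *m C g^T.
    by apply/matrixP=> i j; rewrite !mxE ss'.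
  by rewrite -mulmxA Cgh mulmx1.
Qed.

End CoordinateChange.

(** On the moment curve with coordinates [t ^+ i] each form becomes a nonzero polynomial in [t].
    Characteristic zero supplies more distinct scalars than the product of these polynomials has
    roots. *)
Lemma generic_point (K : fieldType) n (L : seq 'rV[K]_n) : [pchar K] =i pred0 ->
  (forall a, a \in L -> a != 0) -> exists x, forall a, a \in L -> ~~ on_hyp a x.
Proof.
move=> ch0 nzL; pose P := \prod_(a <- L) rVpoly a.
have nzP : P != 0.
  rewrite prodf_seq_neq0; apply/allP=> a aL; apply: contraNneq (nzL a aL) => a0.
  by rewrite -[a]rVpolyK a0 linear0.
pose rs : seq K := [seq k%:R | k <- iota 0 (size P)].
have [t Pt] : exists t, ~~ root P t.
  suff /allPn[t _ Pt] : ~~ all (root P) rs by exists t.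
  apply/negP => /(max_poly_roots nzP); rewrite size_map size_iota ltnn => H.
  suff /H : uniq rs by [].
  rewrite map_inj_uniq ?iota_uniq //.
  have H0 := proj1 (GRing.pcharf0P K) ch0.
  have inj i j : (i <= j)%N -> i%:R = j%:R :> K -> i = j.
    move=> le E; apply/eqP; rewrite eqn_leq le /= -subn_eq0 -H0 natrB //.
    by rewrite E subrr.
  move=> i j E; case: (leqP i j) => [/inj|/ltnW/inj] -> //.
exists (\row_i t ^+ i) => a aL; rewrite on_hypE.
have : ~~ root (rVpoly a) t.
  by apply: contra Pt => ra; rewrite /P (perm_big _ (perm_to_rem aL)) big_cons rootM ra.
apply: contra => /eqP E; apply/rootP; rewrite -[RHS]E.
rewrite (@horner_coef_wide _ n) ?size_poly //; apply: eq_bigr => i _.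
by rewrite coef_rVpoly_ord mxE.
Qed.

Lemma param_exists (K : fieldType) ell (aH : 'rV[K]_ell.+1) : aH != 0 ->
  exists M : 'M[K]_(ell, ell.+1), param_of aH M.
Proof.
move=> nz; have rk : \rank (kermx aH^T) = ell.
  by rewrite mxrank_ker mxrank_tr rank_rV nz subn1.
exists (castmx (rk, erefl _) (row_base (kermx aH^T))) => x.
by rewrite eqmx_cast eq_row_base sub_kermx.
Qed.

(** * Coordinates adapted to [H] and a generic point *)

Section Normalization.
Variables (K : fieldType) (ell : nat) (A : seq 'rV[K]_ell.+1) (aH : 'rV[K]_ell.+1).
Variables (M : 'M[K]_(ell, ell.+1)) (pt : 'rV[K]_ell.+1).
Hypotheses (arrA : is_arrangement A) (memH : aH \in A) (parM : param_of aH M).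
Hypothesis offpt : forall a, a \in A -> ~~ on_hyp a pt.

(** A basis of [H] followed by a point off all hyperplanes. Multiplying a form by the transpose
    lists its values on these vectors, so the first [ell] coefficients give the restriction to
    [H]. *)
Definition frame : 'M[K]_ell.+1 :=
  \matrix_j oapp (fun i => row i M) pt (unlift ord_max j).

Local Notation g := frame^T.
Local Notation A' := [seq a *m g | a <- A].
Local Notation aH' := (aH *m g).

Lemma frame_wid i : row (widen_ord (leqnSn ell) i) frame = row i M.
Proof. by rewrite rowK widE liftK. Qed.

Lemma frame_last : row ord_max frame = pt.
Proof. by rewrite rowK unlift_none. Qed.

Lemma bar_frame a : bar (a *m g) = restr_form M a.
Proof.
apply/rowP=> i; rewrite !mxE; apply: eq_bigr => j _; rewrite !mxE mulrC.
by move/rowP/(_ j): (frame_wid i); rewrite !mxE => ->.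
Qed.

(** Since [pt] lies off [H], subtracting a suitable multiple of it moves any vector into [H], the
    row space of [M]. *)
Lemma frame_unit : g \in unitmx.
Proof.
rewrite unitmx_tr -row_full_unit -sub1mx; apply/row_subP=> i.
move: (row i _) => x; have := offpt memH; rewrite on_hypE => nzp.
set s := \sum_i _ in nzp; pose c := (\sum_i aH 0 i * x 0 i) / s.
have : (x - c *: pt <= M)%MS.
  rewrite parM on_hypE (eq_bigr (fun i => aH 0 i * x 0 i - c * (aH 0 i * pt 0 i))).
    by rewrite sumrB -mulr_sumr -/s divfK // subrr.
  by move=> j _; rewrite !mxE mulrBr mulrCA.
have MF : (M <= frame)%MS.
  by apply/row_subP=> j; rewrite -frame_wid row_sub.
move=> /submx_trans/(_ MF) H; rewrite -[x](subrK (c *: pt)).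
by apply: addmx_sub => //; apply: scalemx_sub; rewrite -frame_last row_sub.
Qed.

Lemma frame_inj : injective (fun a : 'rV[K]_ell.+1 => a *m g).
Proof. by apply: can_inj (mulmx^~ (invmx g)) _ => a; rewrite mulmxK // frame_unit. Qed.

Lemma frame_sub r (a : 'rV_ell.+1) (B : 'M_(r, ell.+1)) :
  (a *m g <= B *m g)%MS = (a <= B)%MS.
Proof. by rewrite submxMfree // row_free_unit frame_unit. Qed.

Lemma normal_frame : normal_arr A' aH'.
Proof.
have [nzA sepA] := arrA; split.
- rewrite map_inj_uniq; last exact: frame_inj.
  apply/(uniqP 0) => i j li lj E; apply/eqP/negP => /negP/eqP ne.
  by apply: (sepA i j li lj ne); exists 1; rewrite scale1r.
- move=> _ _ /mapP[a aA ->] /mapP[b bA ->] ne; rewrite frame_sub.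
  apply/negP => /sub_rVP[c E]; move: aA bA; rewrite -!index_mem => la lb.
  have nei : index a A <> index b A.
    by move=> Ei; case/eqP: ne; congr (_ *m _); rewrite -[a](nth_index 0 (s := A))
      -?index_mem // Ei nth_index // -index_mem.
  apply: (sepA _ _ la lb nei); exists c.
  by rewrite !nth_index -?index_mem.
- move=> _ /mapP[a aA ->]; have := offpt aA; rewrite on_hypE.
  have -> // : (a *m g) 0 ord_max = \sum_i a 0 i * pt 0 i.
  rewrite mxE; apply: eq_bigr => j _.
  by move/rowP/(_ j): frame_last; rewrite [g _ _]mxE [LHS]mxE => ->.
- rewrite bar_frame /restr_form.
  have -> : M *m aH^T = 0; last by rewrite trmx0.
  apply/row_matrixP=> i; rewrite row_mul row0; apply/eqP.
  by rewrite -/(on_hyp aH (row i M)) -parM row_sub.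
- exact: map_f.
Qed.

Lemma deleted_frame : deleted A' aH' = [seq a *m g | a <- deleted A aH].
Proof.
rewrite /deleted filter_map; congr map; apply: eq_filter => a /=.
by rewrite (inj_eq frame_inj).
Qed.

Lemma zmult_frame a : zmult A' aH' (a *m g) = zmult A aH a.
Proof.
rewrite /zmult deleted_frame count_map; apply: eq_count => b /=.
by rewrite -mul_col_mx frame_sub.
Qed.

Lemma restr_multi_frame :
  free_der_module (Dmulti A aH M) <->
  exists k (B : 'M[{mpoly K[ell]}]_(k, ell)), is_basis (Emod A' aH') B.
Proof.
apply: free_der_moduleP => d.
have E a : der_app d (linform a) = lapp a (\row_i d i).
  by rewrite der_app_linform; apply: eq_bigr => i _; rewrite mxE.
split=> H a.
  rewrite deleted_frame => /mapP[b bD ->].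
  by rewrite zmult_frame bar_frame -E; apply: H.
move=> aD; have := H (a *m g); rewrite deleted_frame zmult_frame bar_frame E.
by apply; apply: map_f.
Qed.

Lemma loc_frame x : loc_arr A' x = [seq a *m g | a <- loc_arr A (x *m frame)].
Proof.
rewrite /loc_arr filter_map; congr map; apply: eq_filter => a /=.
by rewrite /on_hyp trmx_mul trmxK mulmxA.
Qed.

End Normalization.

(** * The equivalence, by transport to and from adapted coordinates *)

Theorem mainTheorem8 (K : fieldType) (ell : nat)
  (A : seq 'rV[K]_ell.+1) (aH : 'rV[K]_ell.+1) :
  [pchar K] =i pred0 ->
  (3 <= ell)%N ->
  is_arrangement A ->
  aH \in A ->
  free_arr A <-> (locally_free_along A aH /\ restr_multi_free A aH).
Proof.
move=> ch0 ell3 arrA memH.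
have [pt offpt] := generic_point ch0 (proj1 arrA).
split=> [/free_arrP[k [B bB]]|[locA [M [parM freeM]]]].
  split=> [x _ _|]; first by apply/free_arrP; apply: localization_basis bB.
  have [M parM] := param_exists (proj1 arrA aH memH).
  exists M; split=> //.
  apply/(restr_multi_frame memH parM offpt).
  have nA := normal_frame arrA memH parM offpt.
  have [k1 [B1 bB1]] := basis_lsubst (frame_unit memH parM offpt) bB.
  have [k2 [G bG]] := D0_basis_Dvec nA bB1.
  exists k2, (map_mx (@res K ell) G); apply: (Emod_basis_D0 nA) => // e.
  exact: (res_D0_surj nA bB1).
have ug := frame_unit memH parM offpt.
have nA := normal_frame arrA memH parM offpt.
have /(restr_multi_frame memH parM offpt)[k [EB bEB]] := freeM.
(* Local freeness at [x] in the new coordinates is local freeness of [A] at [x *m frame M pt]. *)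
have [x Hx nzx|G bG] := D0_basis_of_Emod nA _ ell3 bEB.
  rewrite loc_frame; have [||k' [B bB]] := proj1 (free_arrP _) (locA (x *m frame M pt) _ _).
  - by move: Hx; rewrite /on_hyp trmx_mul trmxK mulmxA.
  - apply: contraNneq nzx => x0; have uF : frame M pt \in unitmx by rewrite -unitmx_tr.
    by rewrite -[x](mulmxK uF) x0 mul0mx.
  exact: basis_lsubst bB.
have bD := Dvec_basis_D0 nA bG.
(* The inverse change of coordinates carries the basis back to [A]. *)
have ug' : invmx (frame M pt)^T \in unitmx by rewrite unitmx_inv.
apply/free_arrP; have := basis_lsubst ug' bD.
rewrite -map_comp (@eq_map _ _ _ id) ?map_id // => a /=.
by rewrite mulmxK.
Qed.
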